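(* Let $r>1/2$, $T>0$, and let $\phi$ be given initial data. For $\varepsilon\in(0,1]$ let $w=w(x,t)$ be the exact solution of the quadratic nonlinear Schrödinger equation $$i\partial_t w=-\partial_x^2 w+\varepsilon w^2,\quad x\in\mathbb{T},\ t>0,\qquad w(x,0)=\phi(x),$$ and assume that $w(t)\in H^r(\mathbb{T})$ for $0\le t\le T/\varepsilon$, with $\sup_{0\le t\le T/\varepsilon}\|w(t)\|_r$ bounded uniformly in $\varepsilon$. Let $w^0=\phi$ and let $w^n$ be computed by the first-order low-regularity integrator $$w^{n+1}=\left(1-2i\varepsilon\tau\,\hat w^n_0\right)e^{i\tau\partial_x^2}w^n+i\varepsilon\tau(\hat w^n_0)^2+\frac{\varepsilon}{2}\left[\left(e^{i\tau\partial_x^2}\partial_x^{-1}w^n\right)^2-e^{i\tau\partial_x^2}\left(\partial_x^{-1}w^n\right)^2\right].$$ Then there exist constants $\tau_0>0$ and $C>0$, independent of $\varepsilon$ and $\tau$, such that for all $0<\tau\le\tau_0$, $$\|w(t_n)-w^n\|_r\le C\,\varepsilon\tau,\qquad 0\le n\le\frac{T/\varepsilon}{\tau}.$$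
   Context: $\mathbb{T}=(-\pi,\pi)$ is the one-dimensional torus and $\|\cdot\|_r$ is the standard norm of the Sobolev space $H^r=H^r(\mathbb{T})$ of complex-valued periodic functions. Time grid: $t_n=n\tau$. For $f\in L^2(\mathbb{T})$ write $f(x)=\sum_{l\in\mathbb{Z}}\hat f_l e^{ilx}$; $\hat f_0$ is the zeroth Fourier coefficient, and the scalar $(\hat w_0^n)^2$ is regarded as a constant function. $e^{it\partial_x^2}$ is the Fourier multiplier with symbol $e^{-itl^2}$. $\partial_x^{-1}$ is the Fourier multiplier $\partial_x^{-1}f(x)=\sum_{l\in\mathbb{Z}\setminus\{0\}}\frac{1}{il}\hat f_l e^{ilx}$ (the zero mode is sent to $0$). Solutions are understood in the mild (Duhamel) sense, continuous in time with values in $H^r$. *)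

(* Defs.v *)
From HB Require Import structures.
From mathcomp Require Import all_boot all_order all_algebra.
From mathcomp Require Import complex.
From mathcomp Require Import all_classical all_reals all_analysis.

Set Implicit Arguments.
Unset Strict Implicit.
Unset Printing Implicit Defensive.

Import Order.TTheory GRing.Theory Num.Theory.
Import numFieldNormedType.Exports.

Local Open Scope classical_set_scope.
Local Open Scope ring_scope.

(* Functions on the torus are functions R -> R[i] with period 2 pi; elements of
   L^2 and H^r are represented by such functions, two of them being identified
   when they agree almost everywhere ([ae_eqT]). *)
Section FunctionsOnTheTorus.
Context {R : realType}.

Definition expi (x : R) : R[i] := (cos x +i* sin x)%C.

Definition torus : set R := `]- pi, pi[.

Definition sqmod (z : R[i]) : R := complex.Re z ^+ 2 + complex.Im z ^+ 2.

Definition cintegral (D : set R) (f : R -> R[i]) : R[i] :=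
  ((\int[lebesgue_measure]_(x in D) complex.Re (f x))
   +i* (\int[lebesgue_measure]_(x in D) complex.Im (f x)))%C.

Definition climn (u : nat -> R[i]) : R[i] :=
  (limn (fun n => complex.Re (u n)) +i* limn (fun n => complex.Im (u n)))%C.

Definition ae_eqT (f g : R -> R[i]) : Prop :=
  {ae lebesgue_measure, forall x : R, torus x -> f x = g x}.

Definition L2T (f : R -> R[i]) : Prop :=
  [/\ forall x, f (x + 2 * pi) = f x,
      measurable_fun torus (fun x => complex.Re (f x)),
      measurable_fun torus (fun x => complex.Im (f x)) &
      (\int[lebesgue_measure]_(x in torus) (sqmod (f x))%:E < +oo)%E].

Definition fourier_coef (f : R -> R[i]) (l : int) : R[i] :=
  ((2 * pi)^-1)%:C%C * cintegral torus (fun x => f x * expi (- (l%:~R * x))).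

(* The square root of the sum over l of (1 + l^2)^r |f_l|^2, a possibly infinite
   extended real; it is only meaningful for f in [L2T]. *)
Definition sobolev_norm (r : R) (f : R -> R[i]) : \bar R :=
  sqrte (\esum_(l in [set: int])
           ((1 + l%:~R ^+ 2) `^ r * sqmod (fourier_coef f l))%:E).

Definition Hr (r : R) (f : R -> R[i]) : Prop :=
  L2T f /\ (sobolev_norm r f < +oo)%E.

(* Fourier series are summed pointwise, over -N <= l <= N with N -> oo.  For f in
   H^r with r > 1/2 and a bounded symbol m the series converges absolutely. *)
Definition multiplier (m : int -> R[i]) (f : R -> R[i]) (x : R) : R[i] :=
  climn (fun N => \sum_(k < N.*2.+1)
    let l := k%:Z - N%:Z in m l * fourier_coef f l * expi (l%:~R * x)).

Definition schrodinger (t : R) : (R -> R[i]) -> R -> R[i] :=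
  multiplier (fun l => expi (- (t * l%:~R ^+ 2))).

Definition dx_inv : (R -> R[i]) -> R -> R[i] :=
  multiplier (fun l => if l == 0 then 0 else ('i%C * l%:~R)^-1).

Definition Hr_continuous (r a b : R) (w : R -> R -> R[i]) : Prop :=
  forall t, a <= t <= b -> forall e : R, 0 < e ->
  exists2 d : R, 0 < d & forall s, a <= s <= b -> `|s - t| < d ->
    (sobolev_norm r (fun x => (w s x - w t x)%R) < e%:E)%E.

(* I is the H^r-valued integral of F over [a, b]: the limit, in H^r, of its
   tagged Riemann sums.  It is only used for F continuous with values in H^r,
   where it coincides with the Bochner integral. *)
Definition is_Hr_integral (r a b : R) (F : R -> R -> R[i]) (I : R -> R[i]) :
    Prop :=
  [/\ forall s, a <= s <= b -> Hr r (F s),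
      Hr r I &
      forall e : R, 0 < e -> exists2 d : R, 0 < d &
      forall (n : nat) (p c : nat -> R),
        p 0%N = a -> p n = b ->
        (forall k, (k < n)%N ->
           p k <= c k <= p k.+1 /\ p k.+1 - p k < d) ->
        (sobolev_norm r (fun x =>
           (\sum_(k < n) (p k.+1 - p k)%:C%C * F (c k) x - I x)%R) < e%:E)%E].

(* Mild solution on [0, S] of i w_t = - w_xx + eps w^2, w(0) = phi:
   w(t) = e^{it dxx} phi - i eps int_0^t e^{i(t-s) dxx} (w(s)^2) ds. *)
Definition mild_solution (r eps S : R) (phi : R -> R[i]) (w : R -> R -> R[i]) :
    Prop :=
  [/\ forall t, 0 <= t <= S -> Hr r (w t),
      Hr_continuous r 0 S w,
      ae_eqT (w 0) phi &
      forall t, 0 <= t <= S ->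
      exists2 I : R -> R[i],
        is_Hr_integral r 0 t
          (fun s => schrodinger (t - s) (fun x => w s x ^+ 2)) I &
        ae_eqT (w t) (fun x => schrodinger t phi x - 'i%C * eps%:C%C * I x)].

Definition lri_step (eps tau : R) (v : R -> R[i]) (x : R) : R[i] :=
  let v0 := fourier_coef v 0 in
  (1 - 2 * 'i%C * (eps * tau)%:C%C * v0) * schrodinger tau v x
  + 'i%C * (eps * tau)%:C%C * v0 ^+ 2
  + (eps / 2)%:C%C * (schrodinger tau (dx_inv v) x ^+ 2
                      - schrodinger tau (fun y => dx_inv v y ^+ 2) x).

Definition lri (eps tau : R) (phi : R -> R[i]) (n : nat) : R -> R[i] :=
  iter n (lri_step eps tau) phi.

End FunctionsOnTheTorus.

(* Main.v *)
Require Import Defs.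
From HB Require Import structures.
From mathcomp Require Import all_boot all_order all_algebra.
From mathcomp Require Import complex.
From mathcomp Require Import all_classical all_reals all_analysis.
From mathcomp Require Import measurable_realfun.
From mathcomp Require Import ring lra zify.

Import Order.TTheory GRing.Theory Num.Theory.
Import numFieldNormedType.Exports.
Import Normc.

Set Implicit Arguments.
Unset Strict Implicit.
Unset Printing Implicit Defensive.

Local Open Scope classical_set_scope.
Local Open Scope ring_scope.

(** Read on Fourier coefficients, the equation and the scheme become statements
    about sequences indexed by Z. The free flow multiplies mode l by a number of
    modulus one, so it is an isometry of H^r, and the product of functions
    becomes a convolution, which is bounded on H^r because r > 1/2
    ([bilin_wbound]).

    By Duhamel's formula on one step,
      w(t + tau) = e^{i tau dxx} w(t)
        - i eps int_0^tau e^{i (tau - s) dxx} (w(t + s)^2) ds.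
    Up to an error of size eps s, w(t + s) is the free flow e^{i s dxx} w(t). With
    this replacement the modes k and l - k contribute to mode l the pure
    exponential exp(2 i k (l - k) s), because l^2 - k^2 - (l - k)^2 = 2 k (l - k),
    and its integral in s is explicit. Where k and l - k do not vanish the
    denominator 2 i k (l - k) splits into two factors, which is what [dx_inv]
    computes; the zero modes give the terms with the mean of w. So the step of the
    integrator is exactly the Duhamel integral of the free flow
    ([lri_step_hat]), without any loss of derivatives, and the local error is
    O(eps^2 tau^2) in H^r itself.

    One step of the scheme is Lipschitz with constant 1 + O(eps tau) on bounded
    sets ([one_step_bounds]). Over the at most T / (eps tau) steps the local
    errors add up to O(eps tau), amplified by at most exp(O(T))
    ([gronwall_step]). For tau small the error stays below 1, so the numerical
    solution stays in the ball where the Lipschitz bound was taken.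

    Two points connect functions and sequences. The square of an H^r function
    must have the convolution as its Fourier coefficients; this rests on the
    uniqueness theorem for Fourier coefficients ([null_spectrum_eq0]). And the
    integral in Duhamel's formula is a limit of Riemann sums in H^r: it is used
    through the limits of its modes ([mild_solution_seq]), and norm bounds on
    Riemann sums pass to such limits by Fatou's lemma ([wbound_lim]). *)

(** * Limits of complex sequences *)
Section ComplexLimits.
Context {R : realType}.
Implicit Types (z : R[i]) (u v : nat -> R[i]) (x y : R).

Lemma cReD z1 z2 : complex.Re (z1 + z2) = complex.Re z1 + complex.Re z2 :> R.
Proof. by case: z1 => ? ?; case: z2. Qed.
Lemma cImD z1 z2 : complex.Im (z1 + z2) = complex.Im z1 + complex.Im z2 :> R.
Proof. by case: z1 => ? ?; case: z2. Qed.
Lemma cReN z : complex.Re (- z) = - complex.Re z :> R.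
Proof. by case: z. Qed.
Lemma cImN z : complex.Im (- z) = - complex.Im z :> R.
Proof. by case: z. Qed.
Lemma cReM z1 z2 : complex.Re (z1 * z2) =
  complex.Re z1 * complex.Re z2 - complex.Im z1 * complex.Im z2 :> R.
Proof. by case: z1 => ? ?; case: z2. Qed.
Lemma cImM z1 z2 : complex.Im (z1 * z2) =
  complex.Re z1 * complex.Im z2 + complex.Im z1 * complex.Re z2 :> R.
Proof. by case: z1 => ? ?; case: z2. Qed.

Lemma complex_ext z1 z2 : complex.Re z1 = complex.Re z2 ->
  complex.Im z1 = complex.Im z2 -> z1 = z2.
Proof. by case: z1 => ? ?; case: z2 => ? ? /= -> ->. Qed.

Lemma Re_sum (I : Type) (s : seq I) (P : pred I) (F : I -> R[i]) :
  complex.Re (\sum_(i <- s | P i) F i) = \sum_(i <- s | P i) complex.Re (F i) :> R.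
Proof. exact: (big_morph (@complex.Re R) cReD). Qed.
Lemma Im_sum (I : Type) (s : seq I) (P : pred I) (F : I -> R[i]) :
  complex.Im (\sum_(i <- s | P i) F i) = \sum_(i <- s | P i) complex.Im (F i) :> R.
Proof. exact: (big_morph (@complex.Im R) cImD). Qed.

Lemma normc_ge0 z : 0 <= normc z.
Proof. by case: z => a b; rewrite /normc sqrtr_ge0. Qed.

Lemma normcD z1 z2 : normc (z1 + z2) <= normc z1 + normc z2.
Proof. exact: (@le_normcD R z1 z2). Qed.

Lemma normcB z1 z2 : normc (z1 - z2) <= normc z1 + normc z2.
Proof. by apply: le_trans (normcD _ _) _; rewrite normcN. Qed.

Lemma normc_distC z1 z2 : normc (z1 - z2) = normc (z2 - z1).
Proof. by rewrite -opprB normcN. Qed.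

Lemma normc_real x : normc (x%:C)%C = `|x|.
Proof. by rewrite /normc /= expr0n addr0 sqrtr_sqr. Qed.

Lemma normc_i : normc ('i%C : R[i]) = 1.
Proof. by rewrite /normc /= expr0n add0r expr1n sqrtr1. Qed.

Lemma normc_Re z : `|complex.Re z| <= normc z.
Proof. by case: z => a b; rewrite /normc /= -sqrtr_sqr ler_wsqrtr // lerDl sqr_ge0. Qed.
Lemma normc_Im z : `|complex.Im z| <= normc z.
Proof. by case: z => a b; rewrite /normc /= -sqrtr_sqr ler_wsqrtr // lerDr sqr_ge0. Qed.

Lemma normc_le_ReIm z : normc z <= `|complex.Re z| + `|complex.Im z|.
Proof.
rewrite {1}[z]complexE; apply: le_trans (normcD _ _) _.
by rewrite normcM normc_i mul1r !normc_real.
Qed.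

Lemma normc_sum (I : Type) (s : seq I) (P : pred I) (F : I -> R[i]) :
  normc (\sum_(i <- s | P i) F i) <= \sum_(i <- s | P i) normc (F i).
Proof.
elim/big_ind2 : _ => //; first by rewrite normc0.
by move=> z1 x1 z2 x2 h1 h2; apply: le_trans (normcD _ _) (lerD h1 h2).
Qed.

Lemma sqmodE z : sqmod z = normc z ^+ 2.
Proof. by case: z => a b; rewrite /sqmod /normc /= sqr_sqrtr // addr_ge0 ?sqr_ge0. Qed.

Lemma sqmod_ge0 z : 0 <= sqmod z.
Proof. by rewrite sqmodE sqr_ge0. Qed.

(** Convergence of the two components is what [climn] is built on; [ctendsP] is
    the equivalent form with the modulus. *)
Definition ctends u z :=
  (fun n => complex.Re (u n)) @ \oo --> complex.Re z /\
  (fun n => complex.Im (u n)) @ \oo --> complex.Im z.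

Lemma ctends_climn u z : ctends u z -> climn u = z.
Proof.
by case=> hr hi; rewrite /climn (cvg_lim _ hr)// (cvg_lim _ hi)//; case: z {hr hi}.
Qed.

Lemma ctends_unique u z1 z2 : ctends u z1 -> ctends u z2 -> z1 = z2.
Proof. by move=> /ctends_climn <- /ctends_climn. Qed.

Lemma ctendsP u z : ctends u z <->
  (forall e : R, 0 < e -> exists N, forall n, (N <= n)%N -> normc (u n - z) < e).
Proof.
split=> [[hr hi] e e0|h].
  have e2 : 0 < e / 2 by rewrite divr_gt0.
  move/cvgrPdist_lt : hr => /(_ _ e2) [N1 _ h1].
  move/cvgrPdist_lt : hi => /(_ _ e2) [N2 _ h2].
  exists (maxn N1 N2) => n; rewrite geq_max => /andP[l1 l2].
  apply: le_lt_trans (normc_le_ReIm _) _.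
  rewrite cReD cReN cImD cImN (distrC (complex.Re _)) (distrC (complex.Im _)).
  by rewrite [ltRHS](splitr e) ltrD //; [exact: h1|exact: h2].
split; apply/cvgrPdist_lt => e /h [N hN]; exists N => // n /= /hN;
  rewrite normc_distC; apply: le_lt_trans.
- by rewrite -cReN -cReD; exact: normc_Re.
- by rewrite -cImN -cImD; exact: normc_Im.
Qed.

Lemma ctends_cst z : ctends (fun=> z) z.
Proof. by split; exact: cvg_cst. Qed.

Lemma ctendsD u v z1 z2 : ctends u z1 -> ctends v z2 ->
  ctends (fun n => u n + v n) (z1 + z2).
Proof.
move=> [h1 h2] [h3 h4]; rewrite /ctends cReD cImD.
by split; [under eq_fun do rewrite cReD|under eq_fun do rewrite cImD]; exact: cvgD.
Qed.

Lemma ctendsM u v z1 z2 : ctends u z1 -> ctends v z2 ->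
  ctends (fun n => u n * v n) (z1 * z2).
Proof.
move=> [h1 h2] [h3 h4]; rewrite /ctends cReM cImM.
split; [under eq_fun do rewrite cReM|under eq_fun do rewrite cImM].
- by apply: cvgB; apply: cvgM.
- by apply: cvgD; apply: cvgM.
Qed.

Lemma ctendsZ c u z : ctends u z -> ctends (fun n => c * u n) (c * z).
Proof. by apply: ctendsM; exact: ctends_cst. Qed.

Lemma ctendsB u v z1 z2 : ctends u z1 -> ctends v z2 ->
  ctends (fun n => u n - v n) (z1 - z2).
Proof.
move=> h1 h2; rewrite -mulN1r; under eq_fun do rewrite -mulN1r.
by apply: ctendsD => //; exact: ctendsZ.
Qed.

Lemma ctends_sum (I : Type) (s : seq I) (F : I -> nat -> R[i]) (z : I -> R[i]) :
  (forall i, ctends (F i) (z i)) ->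
  ctends (fun n => \sum_(i <- s) F i n) (\sum_(i <- s) z i).
Proof.
move=> h; elim: s => [|i s IH].
  by rewrite big_nil; under eq_fun do rewrite big_nil; exact: ctends_cst.
by rewrite big_cons; under eq_fun do rewrite big_cons; exact: ctendsD.
Qed.

Lemma ctends_normc_le u z K : ctends u z -> (forall n, normc (u n) <= K) ->
  normc z <= K.
Proof.
move=> /ctendsP h hK; apply/ler_addgt0Pr => e e0.
have [N /(_ N (leqnn _))] := h _ e0; rewrite normc_distC => hN.
rewrite -[z](subrK (u N)); apply: le_trans (normcD _ _) _.
by rewrite addrC lerD // ltW.
Qed.

Lemma ctends_eq u v z : (forall n, u n = v n) -> ctends v z -> ctends u z.
Proof. by move=> /funext ->. Qed.

Lemma ctends_near u v z : (exists N, forall n, (N <= n)%N -> u n = v n) ->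
  ctends v z -> ctends u z.
Proof.
move=> [N hN] /ctendsP h; apply/ctendsP => e /h [M hM].
by exists (maxn N M) => n; rewrite geq_max => /andP[/hN -> /hM].
Qed.

Lemma ctends_normc u z : ctends u z -> (fun n => normc (u n)) @ \oo --> normc z.
Proof.
move=> /ctendsP h; apply/cvgrPdist_lt => e /h [N hN]; exists N => // n /= /hN hn.
have := normcD (u n - z) z; have := normcD (z - u n) (u n).
rewrite !subrK (normc_distC z) => h1 h2; rewrite ltr_norml; lra.
Qed.

End ComplexLimits.

Lemma inv_succ_small (R : realType) (s d : R) : 0 < d ->
  exists N, forall n, (N <= n)%N -> s / n.+1%:R < d.
Proof.
move=> d0; exists (Num.truncn (s / d)) => n Nn.
rewrite ltr_pdivrMr ?ltr0n // mulrC -ltr_pdivrMr //.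
by apply: lt_le_trans (truncnS_gt _) _; rewrite ler_nat.
Qed.

(** * Symmetric sums over the integers *)
Section SumsOverZ.

(** The partial sums by which [multiplier] sums Fourier series. *)
Definition psum {V : nmodType} (N : nat) (u : int -> V) : V :=
  \sum_(k < N.*2.+1) u (k%:Z - N%:Z).

Definition zball (N : nat) : seq int := [seq (k%:Z - N%:Z) | k <- iota 0 N.*2.+1].

Lemma zball_uniq N : uniq (zball N).
Proof. by rewrite map_inj_uniq ?iota_uniq // => i j /addIr []. Qed.

Lemma mem_zball N (l : int) : (l \in zball N) = (`|l|%N <= N)%N.
Proof.
apply/mapP/idP => [[k]|h]; first by rewrite mem_iota => /andP[_ h] ->; lia.
exists (`|(l + N%:Z)%R|%N); last by lia.
by rewrite mem_iota; apply/andP; split; lia.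
Qed.

Lemma psum_zball (V : nmodType) N (u : int -> V) : psum N u = \sum_(l <- zball N) u l.
Proof. by rewrite /psum /zball big_map -(big_mkord xpredT (fun k => u (k%:Z - N%:Z))) /index_iota subn0. Qed.

Lemma psum0 (V : nmodType) (u : int -> V) : psum 0 u = u 0.
Proof. by rewrite /psum big_ord1 subr0. Qed.

Lemma psumS (V : nmodType) N (u : int -> V) :
  psum N.+1 u = psum N u + (u N.+1%:Z + u (- N.+1%:Z)).
Proof.
rewrite /psum doubleS big_ord_recr big_ord_recl /= sub0r.
have -> : N.*2.+2%:Z - N.+1%:Z = N.+1%:Z by lia.
under eq_bigr => k _.
  have -> : (bump 0 k)%:Z - N.+1%:Z = k%:Z - N%:Z by rewrite /bump /=; lia.
  over.
by rewrite [u (- _) + _]addrC -addrA [u (- _) + _]addrC.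
Qed.

Lemma eq_psum (V : nmodType) N (u v : int -> V) :
  (forall l, (`|l| <= N)%N -> u l = v l) -> psum N u = psum N v.
Proof.
move=> h; rewrite !psum_zball; apply: eq_big_seq => l; rewrite mem_zball; exact: h.
Qed.

Lemma psumD (V : nmodType) N (u v : int -> V) :
  psum N (fun l => u l + v l) = psum N u + psum N v.
Proof. exact: big_split. Qed.

Lemma psum_exchange (V : nmodType) N M (u : int -> int -> V) :
  psum N (fun k => psum M (u k)) = psum M (fun l => psum N (u ^~ l)).
Proof. exact: exchange_big. Qed.

Lemma psum_sum (V : nmodType) (I : Type) (s : seq I) N (u : I -> int -> V) :
  psum N (fun k => \sum_(i <- s) u i k) = \sum_(i <- s) psum N (u i).
Proof. exact: exchange_big. Qed.

Lemma psumZ (A : pzRingType) N c (u : int -> A) :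
  psum N (fun l => c * u l) = c * psum N u.
Proof. by rewrite /psum mulr_sumr. Qed.

Context {R : realType}.
Implicit Types (u v : int -> R[i]) (x y : int -> R).

Lemma psum_ge0 N y : (forall l, 0 <= y l) -> 0 <= psum N y.
Proof. by move=> h; exact: sumr_ge0. Qed.

Lemma ler_psum N x y : (forall l, x l <= y l) -> psum N x <= psum N y.
Proof. by move=> h; exact: ler_sum. Qed.

Lemma uniq_sum_le (s t : seq int) y : (forall l, 0 <= y l) -> uniq s -> uniq t ->
  {subset s <= t} -> \sum_(l <- s) y l <= \sum_(l <- t) y l.
Proof.
move=> y0 us ut st.
rewrite [leRHS](bigID (mem s)) /= -[X in _ <= X + _]big_filter.
have hp : perm_eq [seq i <- t | i \in s] s.
  apply: uniq_perm; rewrite ?filter_uniq // => l; rewrite mem_filter.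
  by case: (boolP (l \in s)) => // /st ->.
by rewrite (perm_big _ hp) /= lerDl sumr_ge0.
Qed.

Lemma psum_homo N M y : (forall l, 0 <= y l) -> (N <= M)%N -> psum N y <= psum M y.
Proof.
move=> y0 NM; rewrite !psum_zball; apply: uniq_sum_le; rewrite ?zball_uniq // => l.
by rewrite !mem_zball => /leq_trans; apply.
Qed.

(** Any finite set of integers lies in some [-N, N], so a bound on the symmetric
    partial sums of a nonnegative function bounds every finite sum of it, in
    particular sums along translated or reflected indices. *)
Lemma uniq_sum_psum (s : seq int) y K : (forall l, 0 <= y l) ->
  (forall N, psum N y <= K) -> uniq s -> \sum_(l <- s) y l <= K.
Proof.
move=> y0 hK us; pose N := \max_(l <- s) `|l|%N; apply: le_trans (hK N).
rewrite psum_zball; apply: uniq_sum_le; rewrite ?zball_uniq // => l ls.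
by rewrite mem_zball /N (big_rem l ls) /= leq_maxl.
Qed.

Lemma psum_comp (f : int -> int) y K N : injective f -> (forall l, 0 <= y l) ->
  (forall N, psum N y <= K) -> psum N (y \o f) <= K.
Proof.
move=> fi y0 hK; rewrite psum_zball -(big_map f xpredT).
by apply: uniq_sum_psum; rewrite // map_inj_uniq // zball_uniq.
Qed.

Lemma psum_term_le y K l : (forall l, 0 <= y l) -> (forall N, psum N y <= K) -> y l <= K.
Proof.
by move=> y0 hK; have := uniq_sum_psum (s := [:: l]) y0 hK isT; rewrite big_seq1.
Qed.

(** Absolute summability with an explicit bound, stated on partial sums so that
    all estimates stay among real numbers. *)
Definition summable_by u K := forall N, psum N (fun l => normc (u l)) <= K.

Definition csum u := climn (psum ^~ u).

Lemma normc_psum N u : normc (psum N u) <= psum N (fun l => normc (u l)).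
Proof. exact: normc_sum. Qed.

Lemma psum_cvg y K : (forall l, 0 <= y l) -> (forall N, psum N y <= K) ->
  cvgn (psum ^~ y).
Proof.
move=> y0 hK; apply: nondecreasing_is_cvgn; first by move=> N M NM; exact: psum_homo.
by exists K => _ [N _ <-]; exact: hK.
Qed.

(** x is the difference of the nonnegative functions x + y and y, whose partial
    sums increase and stay bounded. *)
Lemma rpsum_cvg x y K : (forall l, `|x l| <= y l) -> (forall N, psum N y <= K) ->
  cvgn (psum ^~ x).
Proof.
move=> xy hK.
have y0 l : 0 <= y l by apply: le_trans (xy l).
have xy' l : 0 <= x l + y l by case/ler_normlP: (xy l) => ? ?; lra.
have -> : psum ^~ x = (fun N => psum N (fun l => x l + y l) - psum N y).
  by apply/funext => N; rewrite psumD addrK.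
apply: is_cvgB; last exact: psum_cvg hK.
apply: (@psum_cvg _ (K + K)) => // N; rewrite psumD lerD //.
apply: le_trans (hK N); apply: ler_psum => l; exact: le_trans (ler_norm _) (xy l).
Qed.

Lemma csum_cvg u y K : (forall l, normc (u l) <= y l) -> (forall N, psum N y <= K) ->
  ctends (psum ^~ u) (csum u).
Proof.
move=> uy hK.
have hr : cvgn (psum ^~ (fun l => complex.Re (u l))).
  by apply: (@rpsum_cvg _ y K) => // l; apply: le_trans (normc_Re _) (uy l).
have hi : cvgn (psum ^~ (fun l => complex.Im (u l))).
  by apply: (@rpsum_cvg _ y K) => // l; apply: le_trans (normc_Im _) (uy l).
have eR : (fun N => complex.Re (psum N u)) = psum ^~ (fun l => complex.Re (u l)).
  by apply/funext => N; rewrite /psum Re_sum.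
have eI : (fun N => complex.Im (psum N u)) = psum ^~ (fun l => complex.Im (u l)).
  by apply/funext => N; rewrite /psum Im_sum.
by rewrite /ctends /csum /climn /= eR eI.
Qed.

Lemma summable_by_cvg u K : summable_by u K -> ctends (psum ^~ u) (csum u).
Proof. by move=> h; exact: (csum_cvg (y := fun l => normc (u l)) _ h). Qed.

Lemma csum_eq u v : (forall l, u l = v l) -> csum u = csum v.
Proof. by move=> /funext ->. Qed.

Lemma csumD u v K L : summable_by u K -> summable_by v L ->
  csum (fun l => u l + v l) = csum u + csum v.
Proof.
move=> hu hv; apply: ctends_climn; under eq_fun do rewrite psumD.
by apply: ctendsD; exact: summable_by_cvg; eassumption.
Qed.

Lemma csumZ c u K : summable_by u K -> csum (fun l => c * u l) = c * csum u.
Proof.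
move=> hu; apply: ctends_climn; under eq_fun do rewrite psumZ.
by apply: ctendsZ; apply: summable_by_cvg; eassumption.
Qed.

Lemma summableZ c u K : summable_by u K -> summable_by (fun l => c * u l) (normc c * K).
Proof.
move=> hu N; under [X in psum N X]eq_fun do rewrite normcM.
by rewrite psumZ ler_wpM2l ?normc_ge0.
Qed.

Lemma csum_sum (I : Type) (s : seq I) (u : I -> int -> R[i]) K :
  (forall i, summable_by (u i) K) ->
  csum (fun l => \sum_(i <- s) u i l) = \sum_(i <- s) csum (u i).
Proof.
move=> h; apply: ctends_climn; under eq_fun do rewrite psum_sum.
by apply: ctends_sum => i; exact: summable_by_cvg (h i).
Qed.

Lemma psum_delta (V : nmodType) (j : int) (F : int -> V) N : (`|j| <= N)%N ->
  psum N (fun l => if l == j then F l else 0) = F j.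
Proof.
move=> jN; rewrite psum_zball (bigD1_seq j) ?zball_uniq ?mem_zball //= eqxx.
by rewrite big1 ?addr0 // => l /negPf ->.
Qed.

Lemma ctends_delta (j : int) u :
  ctends (psum ^~ (fun l => if l == j then u l else 0)) (u j).
Proof.
apply: ctends_near (ctends_cst _); exists `|j|%N => N; exact: psum_delta.
Qed.

Lemma csum_delta (j : int) u : csum (fun l => if l == j then u l else 0) = u j.
Proof. exact: ctends_climn (ctends_delta _ _). Qed.

(** Two partial sums of u differ by at most the corresponding difference for the
    majorant y; let the longer one tend to the full sum. *)
Lemma csum_tail u y K N : (forall l, normc (u l) <= y l) -> (forall N, psum N y <= K) ->
  normc (csum u - psum N u) <= limn (psum ^~ y) - psum N y.
Proof.
move=> uy hK.
have y0 l : 0 <= y l by apply: le_trans (normc_ge0 _) (uy l).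
have cy := psum_cvg y0 hK.
have cu := csum_cvg uy hK.
apply: (ctends_normc_le (u := fun M => psum (N + M) u - psum N u)).
  apply: ctendsB; last exact: ctends_cst.
  move/ctendsP : cu => cu; apply/ctendsP => e /cu [M hM]; exists M => n Mn.
  by apply: hM; rewrite (leq_trans Mn) // leq_addl.
move=> M; apply: (@le_trans _ _ (psum (N + M) y - psum N y)); last first.
  rewrite lerD2r; apply: nondecreasing_cvgn_le => // i j ij; exact: psum_homo.
elim: M => [|M IH]; first by rewrite addn0 !subrr normc0.
rewrite addnS !psumS ![_ + (_ + _) - _]addrAC; apply: le_trans (normcD _ _) _.
by rewrite lerD // (le_trans (normcD _ _)) // lerD.
Qed.

(** Dominated convergence for series: cut at an N beyond which the majorant
    contributes less than e / 3; both tails are then small uniformly in n, and the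
    finitely many remaining terms converge. *)
Lemma csum_dominated (x : nat -> int -> R[i]) (z : int -> R[i]) y K :
  (forall n l, normc (x n l) <= y l) -> (forall N, psum N y <= K) ->
  (forall l, ctends (x ^~ l) (z l)) -> ctends (fun n => csum (x n)) (csum z).
Proof.
move=> xy hK xz.
have y0 l : 0 <= y l by apply: le_trans (normc_ge0 _) (xy 0%N l).
have zy l : normc (z l) <= y l by apply: ctends_normc_le (xz l) _ => n; exact: xy.
apply/ctendsP => e e0; have e3 : 0 < e / 3 by lra.
have /cvgrPdist_lt /(_ _ e3) [N _ /(_ N (leqnn _)) hN] : psum ^~ y @ \oo --> limn (psum ^~ y).
  exact: psum_cvg hK.
have /ctendsP /(_ _ e3) [M hM] : ctends (fun n => psum N (x n)) (psum N z).
  exact: ctends_sum.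
exists M => n /hM hn.
have h1 := csum_tail N (xy n) hK.
have h2 := csum_tail N zy hK.
have h3 : limn (psum ^~ y) - psum N y < e / 3 by apply: le_lt_trans hN; exact: ler_norm.
have -> : csum (x n) - csum z = (csum (x n) - psum N (x n)) + (psum N (x n) - psum N z)
   - (csum z - psum N z) by ring.
apply: le_lt_trans (normcB _ _) _.
have := normcD (csum (x n) - psum N (x n)) (psum N (x n) - psum N z); lra.
Qed.

Lemma esum_psum_le y (K : R) : (forall l, 0 <= y l) ->
  (\esum_(l in [set: int]) (y l)%:E <= K%:E)%E <-> (forall N, psum N y <= K).
Proof.
move=> y0; split=> h.
  move=> N; rewrite -lee_fin; apply: le_trans h; apply: esum_ge.
  exists [set` zball N]; first by split => //; exact: finite_seq.
  by rewrite -fsbig_seq ?zball_uniq // sumEFin psum_zball.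
apply: ge_ereal_sup => _ [X [finX _] <-].
rewrite fsbig_finite //= sumEFin lee_fin; apply: uniq_sum_psum => //; exact: finmap.fset_uniq.
Qed.

End SumsOverZ.

(** * Integration on the torus *)
Section ComplexExponential.
Context {R : realType}.
Implicit Types (x y : R).

Lemma expi0 : expi (0 : R) = 1.
Proof. by rewrite /expi cos0 sin0. Qed.

Lemma expiD x y : expi (x + y) = expi x * expi y.
Proof.
rewrite /expi cosD sinD; apply: complex_ext; rewrite ?cReM ?cImM //=.
by rewrite addrC.
Qed.

Lemma normc_expi x : normc (expi x) = 1.
Proof. by rewrite /expi /normc cos2Dsin2 sqrtr1. Qed.

Lemma expi_neq0 x : expi x != 0.
Proof. by apply/eqP => h; have := normc_expi x; rewrite h normc0 => /eqP; rewrite eq_sym oner_eq0. Qed.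

Lemma expiN x : expi (- x) = (expi x)^-1.
Proof. by apply: (mulfI (expi_neq0 x)); rewrite -expiD subrr expi0 divff ?expi_neq0. Qed.

Lemma expi_natpi (n : nat) : expi (n%:R * (2 * pi) : R) = 1.
Proof.
elim: n => [|n IH]; first by rewrite mul0r expi0.
rewrite -[n.+1]addn1 natrD mulrDl mul1r expiD IH mul1r /expi.
by rewrite mulr2n mulrDl mul1r -mulr2n cos2pi sin2pi.
Qed.

Lemma expi_intpi (k : int) : expi (k%:~R * (2 * pi) : R) = 1.
Proof.
case: k => n; first exact: expi_natpi.
by rewrite NegzE mulrNz mulNr expiN expi_natpi invr1.
Qed.

Lemma expi_periodic (k : int) x : expi (k%:~R * (x + 2 * pi)) = expi (k%:~R * x).
Proof. by rewrite mulrDr expiD expi_intpi mulr1. Qed.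

End ComplexExponential.

Section ComplexIntegration.
Context {R : realType}.
Implicit Types (f g h : R -> R[i]).

Notation mu := (@lebesgue_measure R).
Notation TT := (@torus R).

Lemma measurable_torus : @measurable _ (measurableTypeR R) TT.
Proof. exact: measurable_itv. Qed.
Hint Resolve measurable_torus : core.

Lemma measurable_EFin_torus (q : R -> R) : measurable_fun TT q ->
  @measurable_fun _ _ (measurableTypeR R) (\bar R) TT (EFin \o q).
Proof. by move=> mq; apply/(@measurable_EFinP _ (measurableTypeR R)). Qed.

Lemma torus_lty : (mu TT < +oo)%E.
Proof. by rewrite /torus lebesgue_measure_itv /=; case: ifP => _; rewrite ?ltry// -EFinD ltry. Qed.

Definition cintegrable f :=
  mu.-integrable TT (EFin \o (fun x => complex.Re (f x))) /\
  mu.-integrable TT (EFin \o (fun x => complex.Im (f x))).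

Definition cmeasurable f := measurable_fun TT (fun x => complex.Re (f x)) /\
  measurable_fun TT (fun x => complex.Im (f x)).

Definition cbounded f := exists K : R, forall x, TT x -> normc (f x) <= K.

Definition bmeas f := cmeasurable f /\ cbounded f.

Lemma bounded_withP (q : R -> R) (K : R) : (forall x, TT x -> `|q x| <= K) ->
  [bounded q x | x in TT].
Proof.
move=> h; exists K; split; first exact: num_real.
by move=> M KM x Tx; apply: le_trans (h x Tx) (ltW KM).
Qed.

Lemma cbounded_ReIm f : cbounded f -> [bounded complex.Re (f x) | x in TT] /\
  [bounded complex.Im (f x) | x in TT].
Proof.
case=> K hK; split; apply: (@bounded_withP _ K) => x /hK; apply: le_trans.
- exact: normc_Re.
- exact: normc_Im.
Qed.

Lemma bmeas_cintegrable f : bmeas f -> cintegrable f.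
Proof.
move=> [[m1 m2] /cbounded_ReIm [b1 b2]].
by split; apply: measurable_bounded_integrable => //; exact: torus_lty.
Qed.

Lemma cmeasurableM f g : cmeasurable f -> cmeasurable g ->
  cmeasurable (fun x => f x * g x).
Proof.
move=> [m1 m2] [m3 m4]; split.
  under eq_fun do rewrite cReM.
  by apply: measurable_funB; apply: measurable_funM.
under eq_fun do rewrite cImM.
by apply: measurable_funD; apply: measurable_funM.
Qed.

Lemma cmeasurableD f g : cmeasurable f -> cmeasurable g ->
  cmeasurable (fun x => f x + g x).
Proof.
move=> [m1 m2] [m3 m4]; split.
  by under eq_fun do rewrite cReD; apply: measurable_funD.
by under eq_fun do rewrite cImD; apply: measurable_funD.
Qed.

Lemma cmeasurable_cst (c : R[i]) : cmeasurable (fun=> c).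
Proof. by split; exact: measurable_cst. Qed.

Lemma bmeasM f g : bmeas f -> bmeas g -> bmeas (fun x => f x * g x).
Proof.
move=> [mf [K hK]] [mg [L hL]]; split; first exact: cmeasurableM.
exists (K * L) => x Tx; rewrite normcM ler_pM ?normc_ge0 //; [exact: hK|exact: hL].
Qed.

Lemma bmeasD f g : bmeas f -> bmeas g -> bmeas (fun x => f x + g x).
Proof.
move=> [mf [K hK]] [mg [L hL]]; split; first exact: cmeasurableD.
by exists (K + L) => x Tx; apply: le_trans (normcD _ _) _; rewrite lerD ?hK ?hL.
Qed.

Lemma bmeas_cst (c : R[i]) : bmeas (fun=> c).
Proof. by split; [exact: cmeasurable_cst|exists (normc c)]. Qed.

Lemma bmeasZ (c : R[i]) f : bmeas f -> bmeas (fun x => c * f x).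
Proof. by move=> h; apply: bmeasM => //; exact: bmeas_cst. Qed.

Lemma bmeasB f g : bmeas f -> bmeas g -> bmeas (fun x => f x - g x).
Proof.
move=> hf hg; under eq_fun do rewrite -mulN1r.
by apply: bmeasD => //; exact: bmeasZ.
Qed.

Lemma bmeas_sum (I : Type) (s : seq I) (F : I -> R -> R[i]) :
  (forall i, bmeas (F i)) -> bmeas (fun x => \sum_(i <- s) F i x).
Proof.
move=> h; elim: s => [|i s IH].
  by under eq_fun do rewrite big_nil; exact: bmeas_cst.
by under eq_fun do rewrite big_cons; exact: bmeasD.
Qed.

Lemma bmeas_expi (k : R) : bmeas (fun x => expi (k * x)).
Proof.
split; last by exists 1 => x _; rewrite normc_expi.
have ck : continuous (fun x : R => k * x) by move=> x; apply: cvgM; [exact: cvg_cst|exact: cvg_id].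
split; apply: measurable_funTS; apply: continuous_measurable_fun => x.
- by apply: continuous_comp; [exact: ck|exact: continuous_cos].
- by apply: continuous_comp; [exact: ck|exact: continuous_sin].
Qed.

Lemma cintegrableM f h : cintegrable f -> bmeas h -> cintegrable (fun x => f x * h x).
Proof.
move=> [i1 i2] [[m1 m2] /cbounded_ReIm [b1 b2]].
have H (q p : R -> R) : mu.-integrable TT (EFin \o q) -> measurable_fun TT p ->
    [bounded p x | x in TT] -> mu.-integrable TT (EFin \o (fun x => q x * p x)).
  by move=> iq mp bp; exact: (integrableMl measurable_torus iq mp bp).
split.
  under eq_fun do rewrite cReM.
  exact: (integrableB measurable_torus (H _ _ i1 m1 b1) (H _ _ i2 m2 b2)).
under eq_fun do rewrite cImM.
exact: (integrableD measurable_torus (H _ _ i1 m2 b2) (H _ _ i2 m1 b1)).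
Qed.

Lemma cintegrableD f g : cintegrable f -> cintegrable g -> cintegrable (fun x => f x + g x).
Proof.
move=> [i1 i2] [i3 i4]; split.
  under eq_fun do rewrite cReD; exact: (integrableD measurable_torus i1 i3).
under eq_fun do rewrite cImD; exact: (integrableD measurable_torus i2 i4).
Qed.

Lemma cintegrableZ (c : R[i]) f : cintegrable f -> cintegrable (fun x => c * f x).
Proof.
move=> h; under eq_fun do rewrite mulrC; apply: cintegrableM => //; exact: bmeas_cst.
Qed.

Lemma cintegrableB f g : cintegrable f -> cintegrable g -> cintegrable (fun x => f x - g x).
Proof.
by move=> hf hg; under eq_fun do rewrite -mulN1r; apply: cintegrableD => //; exact: cintegrableZ.
Qed.

Lemma cintegrable_cst (c : R[i]) : cintegrable (fun=> c).
Proof. exact: bmeas_cintegrable (bmeas_cst c). Qed.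

Lemma cintegrable_sum (I : Type) (s : seq I) (F : I -> R -> R[i]) :
  (forall i, cintegrable (F i)) -> cintegrable (fun x => \sum_(i <- s) F i x).
Proof.
move=> h; elim: s => [|i s IH].
  by under eq_fun do rewrite big_nil; exact: cintegrable_cst.
by under eq_fun do rewrite big_cons; exact: cintegrableD.
Qed.

Lemma cintegralD f g : cintegrable f -> cintegrable g ->
  cintegral TT (fun x => f x + g x) = cintegral TT f + cintegral TT g.
Proof.
move=> [i1 i2] [i3 i4]; apply: complex_ext; rewrite ?cReD ?cImD /=.
  by under eq_Rintegral do rewrite cReD; rewrite RintegralD.
by under eq_Rintegral do rewrite cImD; rewrite RintegralD.
Qed.

Lemma cintegralZ (c : R[i]) f : cintegrable f ->
  cintegral TT (fun x => c * f x) = c * cintegral TT f.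
Proof.
move=> [i1 i2].
have H (a : R) (q : R -> R) : mu.-integrable TT (EFin \o q) ->
    mu.-integrable TT (EFin \o (fun x => a * q x)).
  by move=> iq; exact: (integrableZl measurable_torus a iq).
apply: complex_ext; rewrite ?cReM ?cImM /=.
  under eq_Rintegral do rewrite cReM.
  by rewrite RintegralB // ?RintegralZl //; exact: H.
under eq_Rintegral do rewrite cImM.
by rewrite RintegralD // ?RintegralZl //; exact: H.
Qed.

Lemma cintegral_ae f g : cintegrable f -> cintegrable g -> ae_eqT f g ->
  cintegral TT f = cintegral TT g.
Proof.
move=> [/measurable_int m1 /measurable_int m2] [/measurable_int m3 /measurable_int m4] fg.
case: fg => A [mA muA HA].
rewrite /cintegral /Rintegral; congr (fine _ +i* fine _)%C; apply: ae_eq_integral => //;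
  by exists A; split=> // x /= hx; apply: HA => /=; apply: contra_not hx => h Tx; rewrite h.
Qed.

Lemma cintegral_ext f g : (forall x, TT x -> f x = g x) ->
  cintegral TT f = cintegral TT g.
Proof.
by move=> h; rewrite /cintegral; congr (_ +i* _)%C; apply: eq_Rintegral => x /set_mem /h ->.
Qed.

Lemma Rintegral_dominated (q_ : nat -> R -> R) (q G : R -> R) :
  (forall n, measurable_fun TT (q_ n)) -> mu.-integrable TT (EFin \o G) ->
  (forall n x, TT x -> `|q_ n x| <= G x) ->
  (forall x, TT x -> (fun n => q_ n x) @ \oo --> q x) ->
  (fun n => \int[mu]_(x in TT) q_ n x) @ \oo --> \int[mu]_(x in TT) q x.
Proof.
move=> mq iG qG qq.
have mq' : measurable_fun TT q by exact: measurable_fun_cvg qq.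
have [i0 _ h] : [/\ mu.-integrable TT (EFin \o q),
    [sequence \int[mu]_(x in TT) `|(EFin \o q_ n) x - (EFin \o q) x|]_n @ \oo --> 0 &
    [sequence \int[mu]_(x in TT) ((EFin \o q_ n) x)]_n @ \oo --> \int[mu]_(x in TT) (EFin \o q) x]%E.
  apply: (@dominated_convergence _ _ _ mu TT measurable_torus _ _ (EFin \o G)) => //.
  - by move=> n; exact: measurable_EFin_torus.
  - exact: measurable_EFin_torus.
  - apply: aeW => x Tx; apply: cvg_EFin; first exact: nearW.
    exact: qq.
  - by apply: aeW => x n Tx; rewrite lee_fin; exact: qG.
apply: fine_cvg; rewrite /Rintegral fineK //.
exact: integrable_fin_num.
Qed.

(** Dominated convergence on both components, with the majorant
    K * (|Re f| + |Im f|). The fixed integrable factor f makes this usable both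
    for truncated Fourier series and for limits of multipliers. *)
Lemma cintegral_dominated f (h_ : nat -> R -> R[i]) h (K : R) : cintegrable f ->
  (forall n, cmeasurable (h_ n)) -> (forall n x, TT x -> normc (h_ n x) <= K) ->
  (forall x, TT x -> ctends (fun n => h_ n x) (h x)) ->
  bmeas h /\ ctends (fun n => cintegral TT (fun x => f x * h_ n x))
                    (cintegral TT (fun x => f x * h x)).
Proof.
move=> cf mh bh hh.
have bmh : bmeas h.
  split; first split.
  - by apply: measurable_fun_cvg (fun n => (mh n).1) _ => x /hh [].
  - by apply: measurable_fun_cvg (fun n => (mh n).2) _ => x /hh [].
  by exists K => x Tx; apply: ctends_normc_le (hh x Tx) _ => n; exact: bh.
split=> //.
have ci n : cintegrable (fun x => f x * h_ n x).
  by apply: cintegrableM => //; split=> //; exists K; exact: bh.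
have iG : mu.-integrable TT (EFin \o (fun x => (`|complex.Re (f x)| + `|complex.Im (f x)|) * K)).
  have [i1 i2] := cf.
  have j1 := integrable_norm i1; have j2 := integrable_norm i2.
  exact: (integrableMl measurable_torus (integrableD measurable_torus j1 j2)
    (@measurable_cst _ _ _ _ _ K) (@bounded_withP (cst K) `|K| (fun x _ => lexx _))).
have bG n x : TT x -> normc (f x * h_ n x) <= (`|complex.Re (f x)| + `|complex.Im (f x)|) * K.
  move=> Tx; rewrite normcM ler_pM ?normc_ge0 ?normc_le_ReIm //; exact: bh.
have cfh x : TT x -> ctends (fun n => f x * h_ n x) (f x * h x) by move=> /hh; exact: ctendsZ.
split=> /=.
  apply: (Rintegral_dominated _ iG).
  - by move=> n; have [/measurable_int/measurable_EFinP] := ci n.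
  - by move=> n x Tx; apply: le_trans (bG n x Tx); exact: normc_Re.
  - by move=> x /cfh [].
apply: (Rintegral_dominated _ iG).
- by move=> n; have [_ /measurable_int/measurable_EFinP] := ci n.
- by move=> n x Tx; apply: le_trans (bG n x Tx); exact: normc_Im.
- by move=> x /cfh [].
Qed.

(** The torus has finite measure and |q| <= 1 + q^2. *)
Lemma L2T_cintegrable f : L2T f -> cintegrable f.
Proof.
case=> _ m1 m2 fin.
have ms : measurable_fun TT (fun x => sqmod (f x)).
  by apply: measurable_funD; apply: measurable_funX.
have is_ : mu.-integrable TT (EFin \o (fun x => 1 + sqmod (f x))).
  have i2 : mu.-integrable TT (EFin \o (fun x => sqmod (f x))).
    apply/integrableP; split; first exact/measurable_EFinP.
    under eq_integral do rewrite /= ger0_norm ?sqmod_ge0 //; exact: fin.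
  have i1 : mu.-integrable TT (EFin \o (fun=> 1)).
    apply: measurable_bounded_integrable => //; first exact: torus_lty.
    exact: (@bounded_withP (fun=> 1) `|1| (fun x _ => lexx _)).
  exact: (integrableD measurable_torus i1 i2).
have le1 (q : R) : `|q| <= 1 + q ^+ 2.
  by rewrite -(real_normK (num_real q)); have := sqr_ge0 (`|q| - 1); nra.
split; apply: (le_integrable measurable_torus _ _ is_) => //.
- exact: measurable_EFin_torus.
- move=> x Tx; rewrite /= lee_fin [leRHS]ger0_norm; last by rewrite ler_wpDl ?sqmod_ge0.
  by apply: le_trans (le1 _) _; rewrite lerD2l /sqmod lerDl sqr_ge0.
- exact: measurable_EFin_torus.
- move=> x Tx; rewrite /= lee_fin [leRHS]ger0_norm; last by rewrite ler_wpDl ?sqmod_ge0.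
  by apply: le_trans (le1 _) _; rewrite lerD2l /sqmod lerDr sqr_ge0.
Qed.

Lemma bmeas_L2T f : (forall x, f (x + 2 * pi) = f x) -> bmeas f -> L2T f.
Proof.
move=> pf [[m1 m2] [K hK]]; split=> //.
have i2 : mu.-integrable TT (EFin \o (fun x => sqmod (f x))).
  apply: measurable_bounded_integrable => //; first exact: torus_lty.
    by apply: measurable_funD; apply: measurable_funX.
  apply: (@bounded_withP _ (K ^+ 2)) => x /hK h.
  by rewrite ger0_norm ?sqmod_ge0 // sqmodE lerXn2r ?nnegrE ?normc_ge0 // (le_trans _ h) ?normc_ge0.
by have := integrable_lty measurable_torus i2.
Qed.

(** |f + g|^2 <= 2 |f|^2 + 2 |g|^2. *)
Lemma L2TD f g : L2T f -> L2T g -> L2T (fun x => f x + g x).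
Proof.
move=> [p1 m1 m2 f1] [p2 m3 m4 f2].
have [m5 m6] := cmeasurableD (conj m1 m2) (conj m3 m4).
have ms (q : R -> R[i]) : measurable_fun TT (fun x => complex.Re (q x)) ->
   measurable_fun TT (fun x => complex.Im (q x)) ->
   measurable_fun TT (fun x => (sqmod (q x))%:E).
  by move=> ? ?; apply/measurable_EFinP/measurable_funD; apply: measurable_funX.
split=> //; first by move=> x; rewrite p1 p2.
apply: (@le_lt_trans _ _ (\int[mu]_(x in TT) ((2%:E * (sqmod (f x))%:E) + (2%:E * (sqmod (g x))%:E)))%E).
  apply: ge0_le_integral => //.
  - by move=> x _; rewrite lee_fin sqmod_ge0.
  - exact: ms.
  - by apply: emeasurable_funD; apply: measurable_funeM; exact: ms.
  - move=> x _; rewrite -!EFinM -EFinD lee_fin /sqmod cReD cImD.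
    by have := sqr_ge0 (complex.Re (f x) - complex.Re (g x));
       have := sqr_ge0 (complex.Im (f x) - complex.Im (g x)); nra.
rewrite ge0_integralD //.
- by rewrite !ge0_integralZl // ?lte_add_pinfty ?lte_mul_pinfty // => *;
     rewrite ?lee_fin ?sqmod_ge0 //; exact: ms.
- by move=> x _; rewrite -EFinM lee_fin mulr_ge0 ?sqmod_ge0.
- by apply: measurable_funeM; exact: ms.
- by move=> x _; rewrite -EFinM lee_fin mulr_ge0 ?sqmod_ge0.
- by apply: measurable_funeM; exact: ms.
Qed.

Lemma L2TN f : L2T f -> L2T (fun x => - f x).
Proof.
move=> [p1 m1 m2 f1]; split.
- by move=> x; rewrite p1.
- by under eq_fun do rewrite cReN; exact: measurable_funN.
- by under eq_fun do rewrite cImN; exact: measurable_funN.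
- by under eq_integral do rewrite /sqmod cReN cImN !sqrrN.
Qed.

End ComplexIntegration.
#[global] Hint Resolve measurable_torus : core.

(** * Fourier coefficients *)
Section FourierCoefficients.
Context {R : realType}.
Implicit Types (f g h : R -> R[i]) (p q : R -> R).

Notation mu := (@lebesgue_measure R).
Notation TT := (@torus R).

Lemma bmeas_char (l : int) : bmeas (fun x : R => expi (- (l%:~R * x))).
Proof. by under eq_fun do rewrite -mulNr; exact: bmeas_expi. Qed.

Lemma fourier_coefD f g l : cintegrable f -> cintegrable g ->
  fourier_coef (fun x => f x + g x) l = fourier_coef f l + fourier_coef g l.
Proof.
move=> cf cg; rewrite /fourier_coef; under eq_fun do rewrite mulrDl.
by rewrite cintegralD ?mulrDr //; apply: cintegrableM => //; exact: bmeas_char.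
Qed.

Lemma fourier_coefZ (c : R[i]) f l : cintegrable f ->
  fourier_coef (fun x => c * f x) l = c * fourier_coef f l.
Proof.
move=> cf; rewrite /fourier_coef; under eq_fun do rewrite -mulrA.
rewrite cintegralZ ?(mulrCA c) //; apply: cintegrableM => //; exact: bmeas_char.
Qed.

Lemma fourier_coefB f g l : cintegrable f -> cintegrable g ->
  fourier_coef (fun x => f x - g x) l = fourier_coef f l - fourier_coef g l.
Proof.
move=> cf cg; under eq_fun do rewrite -mulN1r.
by rewrite fourier_coefD ?fourier_coefZ ?mulN1r //; exact: cintegrableZ.
Qed.

Lemma fourier_coef_sum (I : Type) (s : seq I) (F : I -> R -> R[i]) l :
  (forall i, cintegrable (F i)) ->
  fourier_coef (fun x => \sum_(i <- s) F i x) l = \sum_(i <- s) fourier_coef (F i) l.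
Proof.
move=> h; elim: s => [|i s IH].
  rewrite big_nil; under eq_fun do rewrite big_nil -(mul0r 0).
  by rewrite fourier_coefZ ?mul0r //; exact: cintegrable_cst.
rewrite big_cons -IH -fourier_coefD //; last exact: cintegrable_sum.
by under eq_fun do rewrite big_cons.
Qed.

Lemma fourier_coef_ae f g l : cintegrable f -> cintegrable g -> ae_eqT f g ->
  fourier_coef f l = fourier_coef g l.
Proof.
move=> cf cg [A [mA muA HA]]; rewrite /fourier_coef; congr (_ * _).
apply: cintegral_ae; first by apply: cintegrableM => //; exact: bmeas_char.
  by apply: cintegrableM => //; exact: bmeas_char.
by exists A; split=> // x /= hx; apply: HA => /=; apply: contra_not hx => h Tx; rewrite h.
Qed.

Lemma fourier_coef_shift f (k l : int) :
  fourier_coef (fun x => f x * expi (k%:~R * x)) l = fourier_coef f (l - k).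
Proof.
rewrite /fourier_coef; congr (_ * _); apply: cintegral_ext => x _.
by rewrite -mulrA -expiD; congr (_ * expi _); rewrite intrB; ring.
Qed.

Lemma integral_torus_FTC p q : continuous p -> (forall x : R, is_derive x (1 : R) q (p x)) ->
  \int[mu]_(x in TT) p x = q pi - q (- pi).
Proof.
move=> cp dq.
have dq1 x : derivable q x 1 by exact: ex_derive.
have cq : continuous q by move=> x; exact/differentiable_continuous/derivable1_diffP.
have lt : (- pi < pi :> R) by have := @pi_gt0 R; lra.
rewrite /Rintegral /torus -(@integral_itv_bndoo _ _ _ _ true false); last first.
  by apply: measurable_EFin_torus; apply: measurable_funTS; exact: continuous_measurable_fun.
rewrite (@continuous_FTC2 _ p q) //.
- exact: continuous_subspaceT.
- by split=> //; [apply: cvg_at_right_filter|apply: cvg_at_left_filter]; exact: cq.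
- by move=> x _; rewrite derive1E; exact: derive_val.
Qed.

(** Orthogonality of the characters. For l <> 0 the primitives agree at
    -pi and pi, because exp(2 pi i l) = 1 forces sin(pi l) = 0. *)
Lemma fourier_coef1 (l : int) :
  fourier_coef (fun=> 1 : R[i]) l = if l == 0 then 1 else 0.
Proof.
have pi0 := @pi_gt0 R.
have [->|l0] := eqVneq l 0.
  rewrite /fourier_coef; under eq_fun do rewrite mul0r oppr0 expi0 mulr1.
  rewrite /cintegral (@integral_torus_FTC (cst 1) id) //.
  - rewrite (@integral_torus_FTC (cst 0) (cst 0)) //; last by move=> x; exact: cst_continuous.
    by apply: complex_ext; rewrite ?cReM ?cImM /=; field; lra.
  - exact: cst_continuous.
have lR : (l%:~R : R) != 0 by rewrite intr_eq0.
rewrite /fourier_coef /cintegral.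
have cl : continuous (fun x : R => - (l%:~R * x)).
  by move=> x; apply: continuousN; apply: cvgM; [exact: cvg_cst|exact: cvg_id].
have dl (x : R) : is_derive x (1 : R) (fun x : R => - (l%:~R * x)) (- l%:~R).
  have -> : (fun x : R => - (l%:~R * x)) = (- l%:~R) \*: id.
    by apply/funext => y; exact: (esym (mulNr _ _)).
  by apply: is_derive_eq; rewrite /GRing.scale /= mulr1.
have ds (x : R) : is_derive x (1 : R) (fun x : R => - (l%:~R)^-1 * sin (- (l%:~R * x)))
    (cos (- (l%:~R * x))).
  have -> : (fun x : R => - (l%:~R)^-1 * sin (- (l%:~R * x))) =
     (- (l%:~R)^-1) \*: (sin \o (fun x => - (l%:~R * x))) by [].
  have D := is_derive1_comp (f := @sin R) (g := fun x => - (l%:~R * x))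
    (is_derive_sin (- (l%:~R * x))) (dl x).
  by apply: is_derive_eq; rewrite /GRing.scale /=; field.
have dc (x : R) : is_derive x (1 : R) (fun x : R => (l%:~R)^-1 * cos (- (l%:~R * x)))
    (sin (- (l%:~R * x))).
  have -> : (fun x : R => (l%:~R)^-1 * cos (- (l%:~R * x))) =
     ((l%:~R)^-1) \*: (cos \o (fun x => - (l%:~R * x))) by [].
  have D := is_derive1_comp (f := @cos R) (g := fun x => - (l%:~R * x))
    (is_derive_cos (- (l%:~R * x))) (dl x).
  by apply: is_derive_eq; rewrite /GRing.scale /=; field.
have E1 : \int[mu]_(x in TT) complex.Re (1 * expi (- (l%:~R * x))) = 0.
  under eq_Rintegral do rewrite mul1r /=.
  rewrite (integral_torus_FTC _ ds); last first.
    by move=> x; apply: continuous_comp; [exact: cl|exact: continuous_cos].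
  - rewrite mulrN opprK !sinN.
    have := @expi_intpi R l; rewrite /expi.
    have -> : (l%:~R * (2 * pi) : R) = l%:~R * pi + l%:~R * pi by ring.
    rewrite sinD cosD => -[h1 h2].
    have := cos2Dsin2 (l%:~R * pi : R) => h3.
    have -> : sin (l%:~R * pi : R) = 0 by apply/eqP; rewrite -sqrf_eq0; apply/eqP; lra.
    by ring.
have E2 : \int[mu]_(x in TT) complex.Im (1 * expi (- (l%:~R * x))) = 0.
  under eq_Rintegral do rewrite mul1r /=.
  rewrite (integral_torus_FTC _ dc); last first.
    by move=> x; apply: continuous_comp; [exact: cl|exact: continuous_sin].
  by rewrite mulrN opprK !cosN subrr.
by rewrite E1 E2; apply: complex_ext; rewrite ?cReM ?cImM /=; ring.
Qed.

End FourierCoefficients.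

(** * Uniqueness of Fourier coefficients *)
Section Uniqueness.
Context {R : realType}.
Implicit Types (f g h : R -> R[i]) (p q : R -> R) (A : set R).

Notation mu := (@lebesgue_measure R).
Notation TT := (@torus R).

Definition null_spectrum g := cintegrable g /\ forall l, fourier_coef g l = 0.

(** Uniqueness is proved by enlarging this class. It contains the characters, is
    an algebra, and is closed under bounded pointwise limits; hence it contains
    the indicator of every Borel set, and the zeroth coefficient of such a product
    is the mean of g over that set. *)
Definition null_multiplier h :=
  bmeas h /\ forall g, null_spectrum g -> null_spectrum (fun x => g x * h x).

Lemma nm_cst (c : R[i]) : null_multiplier (fun=> c).
Proof.
split=> [|g [cg g0]]; first exact: bmeas_cst.
split; first by apply: cintegrableM => //; exact: bmeas_cst.
by move=> l; under eq_fun do rewrite mulrC; rewrite fourier_coefZ // g0 mulr0.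
Qed.

Lemma nmM h1 h2 : null_multiplier h1 -> null_multiplier h2 ->
  null_multiplier (fun x => h1 x * h2 x).
Proof.
move=> [b1 n1] [b2 n2]; split=> [|g /n1/n2 hg]; first exact: bmeasM.
by under eq_fun do rewrite mulrA.
Qed.

Lemma nmD h1 h2 : null_multiplier h1 -> null_multiplier h2 ->
  null_multiplier (fun x => h1 x + h2 x).
Proof.
move=> [b1 n1] [b2 n2]; split=> [|g hg]; first exact: bmeasD.
have [c1 z1] := n1 _ hg; have [c2 z2] := n2 _ hg.
under eq_fun do rewrite mulrDr; split=> [|l]; first exact: cintegrableD.
by rewrite fourier_coefD // z1 z2 addr0.
Qed.

Lemma nm_expi (k : int) : null_multiplier (fun x => expi (k%:~R * x)).
Proof.
split=> [|g [cg g0]]; first exact: bmeas_expi.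
split=> [|l]; first by apply: cintegrableM => //; exact: bmeas_expi.
by rewrite fourier_coef_shift g0.
Qed.

Lemma nm_lim (h_ : nat -> R -> R[i]) h (K : R) : (forall n, null_multiplier (h_ n)) ->
  (forall n x, TT x -> normc (h_ n x) <= K) ->
  (forall x, TT x -> ctends (fun n => h_ n x) (h x)) -> null_multiplier h.
Proof.
move=> nh bh hh.
have mh n : cmeasurable (h_ n) by have [[]] := nh n.
split; first by have [] := cintegral_dominated (cintegrable_cst 0) mh bh hh.
move=> g sg; have [cg g0] := sg.
have [bmh _] := cintegral_dominated cg mh bh hh.
split; first exact: cintegrableM.
move=> l; rewrite /fourier_coef.
have cgl := cintegrableM cg (bmeas_char l).
have [_ H] := cintegral_dominated cgl mh bh hh.
suff -> : cintegral TT (fun x => g x * h x * expi (- (l%:~R * x))) = 0 by rewrite mulr0.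
have -> : (fun x => g x * h x * expi (- (l%:~R * x))) =
          (fun x => g x * expi (- (l%:~R * x)) * h x) by apply/funext => x; ring.
apply: (ctends_unique H); apply: ctends_eq (ctends_cst _) => n.
have [_ n1] := nh n; have [_ /(_ l)] := n1 _ sg; rewrite /fourier_coef.
have -> : (fun x => g x * h_ n x * expi (- (l%:~R * x))) =
          (fun x => g x * expi (- (l%:~R * x)) * h_ n x) by apply/funext => x; ring.
move/eqP; rewrite mulf_eq0 -(rmorph0 (real_complex R)) (inj_eq (@complexI R)) invr_eq0.
by rewrite mulf_eq0 pnatr_eq0 (gt_eqF (@pi_gt0 R)) orFb => /eqP.
Qed.

Lemma nm_ext h1 h2 : (forall x, TT x -> h1 x = h2 x) ->
  null_multiplier h1 -> null_multiplier h2.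
Proof.
move=> e n1; have [[_ [K hK]] _] := n1.
apply: (@nm_lim (fun=> h1) h2 K) => // x Tx.
by rewrite -e //; exact: ctends_cst.
Qed.

Definition real_null_multiplier p := null_multiplier (fun x => (p x)%:C%C).

Lemma rnm_cst (c : R) : real_null_multiplier (fun=> c).
Proof. exact: nm_cst. Qed.

Lemma rnmM p q : real_null_multiplier p -> real_null_multiplier q ->
  real_null_multiplier (fun x => p x * q x).
Proof. by move=> np nq; have := nmM np nq; under eq_fun do rewrite -rmorphM. Qed.

Lemma rnmD p q : real_null_multiplier p -> real_null_multiplier q ->
  real_null_multiplier (fun x => p x + q x).
Proof. by move=> np nq; have := nmD np nq; under eq_fun do rewrite -rmorphD. Qed.

Lemma rnmZ (c : R) p : real_null_multiplier p -> real_null_multiplier (fun x => c * p x).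
Proof. by apply: rnmM; exact: rnm_cst. Qed.

Lemma rnm_lim (p_ : nat -> R -> R) p (K : R) : (forall n, real_null_multiplier (p_ n)) ->
  (forall n x, TT x -> `|p_ n x| <= K) ->
  (forall x, TT x -> (fun n => p_ n x) @ \oo --> p x) -> real_null_multiplier p.
Proof.
move=> np bp pp; apply: (nm_lim (K := K) np).
  by move=> n x Tx; rewrite normc_real bp.
by move=> x Tx; split=> /=; [exact: pp|exact: cvg_cst].
Qed.

Lemma rnm_cos : real_null_multiplier cos.
Proof.
have := nmM (nm_cst (2^-1)%:C%C) (nmD (nm_expi 1) (nm_expi (-1))).
apply: nm_ext => x _; rewrite mulrN1z mulr1z mulN1r mul1r /expi cosN sinN.
by apply: complex_ext; rewrite ?cReM ?cImM ?cReD ?cImD /=; field.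
Qed.

Lemma rnm_sin : real_null_multiplier sin.
Proof.
have := nmM (nm_cst (- 'i * (2^-1)%:C)%C) (nmD (nm_expi 1) (nmM (nm_cst (-1)) (nm_expi (-1)))).
apply: nm_ext => x _.
have -> : ((-1)%:~R * x : R) = - x by rewrite mulrN1z mulN1r.
rewrite mulr1z [1 * x]mul1r /expi cosN sinN.
by apply: complex_ext; rewrite ?(cReM, cImM, cReD, cImD, cReN, cImN) /=; field.
Qed.

(** A polynomial that fixes 0, 1/2 and 1; its iterates push ]1/2, 1] to 1 and
    [0, 1/2[ to 0. Iterating it turns a multiplier into the indicator of a
    superlevel set while staying inside the algebra. *)
Definition smoothstep (y : R) : R := 3 * y ^+ 2 - 2 * y ^+ 3.

Lemma smoothstep_itv y : 0 <= y <= 1 -> 0 <= smoothstep y <= 1.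
Proof.
move=> /andP[y0 y1]; apply/andP; split.
  have -> : smoothstep y = y ^+ 2 * (3 - 2 * y) by rewrite /smoothstep; ring.
  by rewrite mulr_ge0 ?sqr_ge0 //; lra.
rewrite -subr_ge0; have -> : 1 - smoothstep y = (1 - y) ^+ 2 * (1 + 2 * y).
  by rewrite /smoothstep; ring.
by rewrite mulr_ge0 ?sqr_ge0 //; lra.
Qed.

Lemma iter_smoothstep_itv n y : 0 <= y <= 1 -> 0 <= iter n smoothstep y <= 1.
Proof. by move=> h; elim: n => //= n /smoothstep_itv. Qed.

(** 1 - smoothstep z = (1 - z) * ((1 - z) (1 + 2 z)), and for z >= y the second
    factor is at most its value c < 1 at y: the distance to 1 decays like c^n. *)
Lemma iter_smoothstep_gt y : 1 / 2 < y <= 1 ->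
  (fun n => iter n smoothstep y) @ \oo --> (1 : R).
Proof.
move=> /andP[y0 y1]; pose c := (1 - y) * (1 + 2 * y).
have c0 : 0 <= c by rewrite /c; nra.
have c1 : c < 1 by rewrite /c; nra.
have H n : y <= iter n smoothstep y <= 1 /\ 1 - iter n smoothstep y <= c ^+ n.
  elim: n => [|n [/andP[h1 h2] h3]]; first by rewrite /= expr0; lra.
  rewrite iterS; move: h1 h2 h3; set z := iter n _ _ => h1 h2 h3.
  have e : 1 - smoothstep z = (1 - z) * ((1 - z) * (1 + 2 * z)) by rewrite /smoothstep; ring.
  have le : (1 - z) * (1 + 2 * z) <= c by rewrite /c; nra.
  have zc : 0 <= (1 - z) * (1 + 2 * z) by nra.
  have cn : 0 <= c ^+ n by exact: exprn_ge0.
  split; last by rewrite e exprSr ler_pM //; lra.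
  have : 0 <= 1 - smoothstep z by rewrite e mulr_ge0 //; lra.
  have : 1 - smoothstep z <= 1 - z by rewrite e ler_piMr //; lra.
  by move=> *; apply/andP; split; lra.
have cc : (fun n => 1 - c ^+ n) @ \oo --> (1 : R).
  rewrite -[X in _ --> X]subr0; apply: cvgB; first exact: cvg_cst.
  by apply: cvg_expr; rewrite ger0_norm.
apply: (squeeze_cvgr _ cc (@cvg_cst _ _ _ _ _)); apply: nearW => n.
by have [/andP[_ ->] h] := H n; rewrite andbT; lra.
Qed.

Lemma iter_smoothstepC n y : iter n smoothstep (1 - y) = 1 - iter n smoothstep y.
Proof. by elim: n => //= n ->; rewrite /smoothstep; ring. Qed.

Lemma iter_smoothstep_half n : iter n smoothstep (1 / 2) = 1 / 2.
Proof. by elim: n => //= n ->; rewrite /smoothstep; field. Qed.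

Definition step (y : R) : R := if 1 / 2 < y then 1 else if y < 1 / 2 then 0 else 1 / 2.

Lemma iter_smoothstep_cvg y : 0 <= y <= 1 ->
  (fun n => iter n smoothstep y) @ \oo --> step y.
Proof.
move=> /andP[y0 y1]; rewrite /step; case: ltgtP => h.
- by apply: iter_smoothstep_gt; rewrite h.
- have := @iter_smoothstep_gt (1 - y).
  under eq_fun do rewrite iter_smoothstepC; move=> H.
  have {}H : (fun n => 1 - iter n smoothstep y) @ \oo --> (1 : R) by apply: H; apply/andP; split; lra.
  have -> : (fun n => iter n smoothstep y) = (fun n => 1 - (1 - iter n smoothstep y)).
    by apply/funext => n; ring.
  by rewrite -(subrr 1); apply: cvgB => //; exact: cvg_cst.
- by rewrite -h; under eq_fun do rewrite iter_smoothstep_half; exact: cvg_cst.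
Qed.

(** The iterates of [smoothstep] converge to 1, 1/2 or 0 according to the sign of
    p - c; the polynomial z (2 z - 1) then kills the value 1/2 taken on the level
    set. *)
Lemma rnm_superlevel p (c : R) : real_null_multiplier p -> (forall x, `|p x| <= 1) -> `|c| <= 1 ->
  real_null_multiplier (\1_[set x | c < p x]).
Proof.
move=> np bp bc.
(* This affine map sends [-2, 2] into [0, 1] and the level c to 1/2. *)
pose y x := 1 / 2 + 1 / 4 * (p x + - c).
have y01 x : 0 <= y x <= 1.
  by move: (bp x) bc; rewrite !ler_norml /y => /andP[? ?] /andP[? ?]; apply/andP; split; lra.
have ny n : real_null_multiplier (fun x => iter n smoothstep (y x)).
  elim: n => [|n IH].
    apply: rnmD; first exact: rnm_cst.
    by apply: rnmZ; apply: rnmD => //; exact: rnm_cst.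
  have -> : (fun x => iter n.+1 smoothstep (y x)) = (fun x =>
      3 * (iter n smoothstep (y x) * iter n smoothstep (y x)) +
      -2 * (iter n smoothstep (y x) * (iter n smoothstep (y x) * iter n smoothstep (y x)))).
    by apply/funext => x; rewrite iterS /smoothstep; ring.
  by apply: rnmD; apply: rnmZ; do ?[apply: rnmM].
have ns : real_null_multiplier (fun x => step (y x)).
  apply: (rnm_lim (K := 1) ny) => [n x _|x _]; last exact: iter_smoothstep_cvg.
  by have /andP[h1 h2] := iter_smoothstep_itv n (y01 x); rewrite ger0_norm.
have := rnmM ns (rnmD (rnmZ 2 ns) (rnm_cst (-1))); congr real_null_multiplier.
apply/funext => x; rewrite /step indicE /y; case: ltgtP => h.
- by rewrite mem_set /=; lra.
- by rewrite memNset /=; [lra|apply/negP; rewrite -leNgt; lra].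
- by rewrite memNset /=; [field|apply/negP; rewrite -leNgt; lra].
Qed.

Definition indic_null_multiplier A := real_null_multiplier (\1_A : R -> R).

Lemma nmset_ext A B : (forall x, TT x -> A x <-> B x) -> indic_null_multiplier A -> indic_null_multiplier B.
Proof.
move=> AB; apply: nm_ext => x Tx; rewrite !indicE; congr ((nat_of_bool _)%:R%:C)%C.
by apply/idP/idP => /set_mem/(AB x Tx)/mem_set.
Qed.

Lemma nmsetC A : indic_null_multiplier A -> indic_null_multiplier (~` A).
Proof.
move=> nA; have := rnmD (rnm_cst 1) (rnmZ (-1) nA); congr real_null_multiplier.
apply/funext => x; rewrite !indicE in_setC; case: (x \in A) => /=; ring.
Qed.

Lemma nmsetI A B : indic_null_multiplier A -> indic_null_multiplier B -> indic_null_multiplier (A `&` B).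
Proof.
move=> nA nB; have := rnmM nA nB; congr real_null_multiplier.
by apply/funext => x; rewrite !indicE in_setI -natrM mulnb.
Qed.

Lemma nmset0 : indic_null_multiplier set0.
Proof. by have := rnm_cst 0; congr real_null_multiplier; apply/funext => x; rewrite indicE in_set0. Qed.

(** The complement of the union is the decreasing limit of the finite
    intersections of complements. *)
Lemma nmset_bigcup (F : (set R)^nat) :
  (forall n, indic_null_multiplier (F n)) -> indic_null_multiplier (\bigcup_k F k).
Proof.
move=> nF; pose G n := \bigcap_(k < n) ~` F k.
have nG n : indic_null_multiplier (G n).
  elim: n => [|n IH].
    have := nmsetC nmset0; apply: nmset_ext => x _.
    by split=> [_ k|_ []].
  have := nmsetI IH (nmsetC (nF n)); apply: nmset_ext => x _; split.
    by move=> [h1 h2] k /=; rewrite ltnS leq_eqVlt => /orP[/eqP ->//|]; exact: h1.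
  by move=> h; split; [move=> k kn; apply: h; exact: ltnW|exact: (h n (ltnSn n))].
have nI : indic_null_multiplier (\bigcap_k ~` F k).
  apply: (rnm_lim (K := 1) nG).
    by move=> n x _; rewrite indicE; case: (_ \in _); rewrite ?normr1 ?normr0.
  move=> x _; have [h|h] := pselect ((\bigcap_k ~` F k) x).
    rewrite indicE mem_set //; under eq_fun => n.
      rewrite indicE mem_set; last by move=> k _; exact: h.
      over.
    exact: cvg_cst.
  rewrite indicE memNset //; have [k Fk] : exists k, F k x.
    by move: h => /existsNP [k /not_implyP [_ /contrapT]]; exists k.
  apply: cvg_near_cst; exists k.+1 => // n /= kn; rewrite indicE memNset //.
  by move=> /(_ k kn).
have := nmsetC nI; apply: nmset_ext => x _.
by rewrite setC_bigcap; split=> -[k _ h]; exists k => //; move: h; rewrite setCK.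
Qed.

(** On ]-pi, pi[ the sign of sin x is the sign of x and cos x is a decreasing
    function of |x|, so superlevel sets of sin and cos cut out every ray. *)
Lemma nmset_ray (a : R) : indic_null_multiplier `]a, +oo[%classic.
Proof.
have pi0 := @pi_gt0 R.
have [ha|ha] := leP pi a.
  apply: nmset_ext nmset0 => x; rewrite /torus /= !in_itv /= andbT => /andP[_ h].
  by split=> //; lra.
have [hb|hb] := leP a (- pi).
  apply: nmset_ext (nmsetC nmset0) => x; rewrite /torus /= !in_itv /= andbT => /andP[h _].
  by split=> [_|_ []]; exact: le_lt_trans hb h.
have sinp x : TT x -> (0 < sin x) = (0 < x).
  rewrite /torus /= in_itv /= => /andP[h1 h2]; apply/idP/idP => h.
    rewrite ltNge; apply/negP => x0; have := @sin_ge0_pi R (- x).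
    by rewrite sinN; lra.
  by apply: sin_gt0_pi; rewrite h.
have sinn x : TT x -> (0 < -1 * sin x) = (x < 0).
  move=> Tx; rewrite mulN1r -sinN sinp ?oppr_gt0 //.
  by move: Tx; rewrite /torus /= !in_itv /=; lra.
have nabs (q : R -> R) : (forall x, `|q x| <= 1) -> forall x, `|-1 * q x| <= 1.
  by move=> h x; rewrite mulN1r normrN.
have n0 : `|0 : R| <= 1 by rewrite normr0.
have lc x y : 0 <= x <= pi -> 0 <= y <= pi -> (cos x < cos y :> R) = (y < x).
  by move=> hx hy; rewrite ltr_cos ?in_itv.
have [a0|a0] := leP 0 a.
  have nc := rnm_superlevel (c := - cos a) (rnmZ (-1) rnm_cos) (nabs _ (@cos_max R)).
  have := nmsetI (rnm_superlevel rnm_sin (@sin_max R) n0) (nc _).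
  rewrite normrN => /(_ (cos_max a)); apply: nmset_ext => x Tx /=.
  rewrite in_itv /= andbT (sinp _ Tx) mulN1r ltrN2.
  move: Tx; rewrite /torus /= in_itv /= => /andP[h1 h2]; split=> [[x0]|ax].
    by rewrite lc; lra.
  have x0 : 0 < x by lra.
  by split=> //; rewrite lc //; lra.
have nc := rnm_superlevel (c := cos a) rnm_cos (@cos_max R) (cos_max a).
have := nmsetC (nmsetI (rnm_superlevel (rnmZ (-1) rnm_sin) (nabs _ (@sin_max R)) n0) (nmsetC nc)).
apply: nmset_ext => x Tx /=.
rewrite in_itv /= andbT (sinn _ Tx).
move: Tx; rewrite /torus /= in_itv /= => /andP[h1 h2].
rewrite -(cosN a) -(cosN x); split=> [h|ax [x0 []]].
  rewrite ltNge; apply/negP => xa; apply: h; split; first lra.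
  by apply/negP; rewrite -leNgt leNgt lc ?ltrN2 -?leNgt; lra.
by rewrite lc ?ltrN2 //; lra.
Qed.

Lemma nmset_measurable A : @measurable _ (measurableTypeR R) A -> indic_null_multiplier A.
Proof.
rewrite RGenOInfty.measurableE; apply: smallest_sub; last first.
  by move=> _ [a ->]; exact: nmset_ray.
split; first exact: nmset0.
- by move=> B nB; rewrite setTD; exact: nmsetC.
- exact: nmset_bigcup.
Qed.

(** Multiplying by the indicator of a Borel set E keeps the spectrum null, and the
    zeroth coefficient of the product is the mean of g over E: all these means
    vanish. *)
Lemma null_spectrum_eq0 g : null_spectrum g -> ae_eqT g (fun=> 0).
Proof.
move=> sg; have [[i1 i2] g0] := sg.
have H E : @measurable _ (measurableTypeR R) E -> E `<=` TT ->
    \int[mu]_(x in E) complex.Re (g x) = 0 /\ \int[mu]_(x in E) complex.Im (g x) = 0.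
  move=> mE ET; have [_ /(_ _ sg) [_ /(_ 0)]] := nmset_measurable mE.
  rewrite /fourier_coef; under eq_fun do rewrite mul0r oppr0 expi0 mulr1.
  move/eqP; rewrite mulf_eq0 -(rmorph0 (real_complex R)) (inj_eq (@complexI R)) invr_eq0.
  rewrite mulf_eq0 pnatr_eq0 (gt_eqF (@pi_gt0 R)) orFb => /eqP.
  have e (q : R -> R) : \int[mu]_(x in E) q x = \int[mu]_(x in TT) (q x * \1_E x).
    rewrite -[in LHS](setIidr ET) Rintegral_mkcondr; apply: eq_Rintegral => x _.
    by rewrite /patch indicE; case: (x \in E); rewrite ?mulr1 ?mulr0.
  rewrite /cintegral => -[]; rewrite !e => h1 h2; split.
    by rewrite -[RHS]h1; apply: eq_Rintegral => x _; rewrite cReM /= mulr0 subr0.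
  by rewrite -[RHS]h2; apply: eq_Rintegral => x _; rewrite cImM /= mulr0 add0r.
have K (q : R -> R) : mu.-integrable TT (EFin \o q) ->
    (forall E, @measurable _ (measurableTypeR R) E -> E `<=` TT -> \int[mu]_(x in E) q x = 0) ->
    ae_eq mu TT (EFin \o q) (cst 0%E).
  move=> iq hq; apply: integral_ae_eq => // E ET mE.
  rewrite integral0 -[LHS]fineK; last first.
    apply: integrable_fin_num => //.
    by apply: integrableS iq.
  by have := hq E mE ET; rewrite /Rintegral => ->.
have [A1 [mA1 muA1 HA1]] := K _ i1 (fun E mE ET => (H E mE ET).1).
have [A2 [mA2 muA2 HA2]] := K _ i2 (fun E mE ET => (H E mE ET).2).
exists (A1 `|` A2); split; first exact: measurableU.
  by rewrite null_set_setU.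
move=> x /= hx; have [a1|a1] := pselect (A1 x); first by left.
right; apply: HA2 => /= h2; apply: hx => Tx.
have h1 : TT x -> (complex.Re (g x))%:E = 0%E :> \bar R by apply: contrapT => h1; apply: a1; exact: HA1.
by apply: complex_ext; [case: (h1 Tx)|case: (h2 Tx)].
Qed.

End Uniqueness.

(** * Absolutely convergent Fourier series *)
Section FourierSynthesis.
Context {R : realType}.
Implicit Types (f g h : R -> R[i]) (a b : int -> R[i]).

Notation TT := (@torus R).

Definition synth a (x : R) : R[i] := csum (fun k => a k * expi (k%:~R * x)).

Lemma summable_char a K x : summable_by a K ->
  summable_by (fun k => a k * expi (k%:~R * x)) K.
Proof.
by move=> h N; under [X in psum N X]eq_fun do rewrite normcM normc_expi mulr1; exact: h.
Qed.

Lemma synth_periodic a x : synth a (x + 2 * pi) = synth a x.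
Proof. by apply: csum_eq => k; rewrite expi_periodic. Qed.

Lemma bmeas_psum_char a N :
  bmeas (fun x : R => psum N (fun k => a k * expi (k%:~R * x))).
Proof. by apply: bmeas_sum => k; apply: bmeasZ; exact: bmeas_expi. Qed.

(** The series converges boundedly, so it can be integrated term by term against
    g; each term shifts the coefficients of g. *)
Lemma synth_mul g a K : cintegrable g -> summable_by a K ->
  bmeas (synth a) /\
  forall l, fourier_coef (fun x => g x * synth a x) l =
            csum (fun k => a k * fourier_coef g (l - k)).
Proof.
move=> cg sa.
have mh N : cmeasurable (fun x : R => psum N (fun k => a k * expi (k%:~R * x))).
  by case: (bmeas_psum_char a N).
have bh N x : TT x -> normc (psum N (fun k => a k * expi (k%:~R * x))) <= K.
  by move=> _; apply: le_trans (normc_psum _ _) _; exact: summable_char sa N.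
have hh x : TT x -> ctends (fun N => psum N (fun k => a k * expi (k%:~R * x))) (synth a x).
  by move=> _; apply: (summable_by_cvg (K := K)); exact: summable_char.
split=> [|l]; first by have [] := cintegral_dominated cg mh bh hh.
have [_ H] := cintegral_dominated (cintegrableM cg (bmeas_char l)) mh bh hh.
have E : (fun x => g x * synth a x * expi (- (l%:~R * x))) =
         (fun x => g x * expi (- (l%:~R * x)) * synth a x) by apply/funext => x; ring.
rewrite {1}/fourier_coef E; apply: (ctends_unique (ctendsZ _ H)).
suff E2 N : ((2 * pi)^-1)%:C%C * cintegral TT (fun x => g x * expi (- (l%:~R * x)) *
     psum N (fun k => a k * expi (k%:~R * x))) = psum N (fun k => a k * fourier_coef g (l - k)).
  have -> : csum (fun k => a k * fourier_coef g (l - k)) =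
     ((2 * pi)^-1)%:C%C * cintegral TT (fun x => g x * expi (- (l%:~R * x)) * synth a x).
    by apply: ctends_climn; apply: ctends_eq (ctendsZ _ H) => N; rewrite E2.
  exact: ctendsZ.
have -> : (fun x => g x * expi (- (l%:~R * x)) * psum N (fun k => a k * expi (k%:~R * x)))
  = (fun x => (\sum_(i < N.*2.+1) a (i%:Z - N%:Z) * (g x * expi ((i%:Z - N%:Z)%:~R * x)))
        * expi (- (l%:~R * x))).
  apply/funext => x; rewrite mulrAC; congr (_ * _).
  by rewrite /psum mulr_sumr; apply: eq_bigr => i _; ring.
have ci k : cintegrable (fun x => g x * expi (k%:~R * x)).
  by apply: cintegrableM => //; exact: bmeas_expi.
rewrite -/(fourier_coef (fun x => \sum_(i < N.*2.+1)
   a (i%:Z - N%:Z) * (g x * expi ((i%:Z - N%:Z)%:~R * x))) l).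
rewrite fourier_coef_sum => [|i]; last exact: cintegrableZ.
by apply: eq_bigr => i _; rewrite fourier_coefZ // fourier_coef_shift.
Qed.

Lemma synth_bmeas a K : summable_by a K -> bmeas (synth a).
Proof. by move=> sa; have [] := synth_mul (cintegrable_cst 0) sa. Qed.

Lemma synth_cintegrable a K : summable_by a K -> cintegrable (synth a).
Proof. by move=> sa; apply: bmeas_cintegrable; exact: synth_bmeas sa. Qed.

Lemma fourier_coef_synth a K l : summable_by a K -> fourier_coef (synth a) l = a l.
Proof.
move=> sa; have [_ /(_ l)] := synth_mul (cintegrable_cst 1) sa.
under eq_fun do rewrite mul1r; move=> ->.
rewrite -[RHS](csum_delta l a); apply: csum_eq => k.
by rewrite fourier_coef1 subr_eq0 eq_sym; case: ifP => _; rewrite ?mulr1 ?mulr0.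
Qed.

Lemma fourier_coef_synthM a b K L l : summable_by a K -> summable_by b L ->
  fourier_coef (fun x => synth a x * synth b x) l = csum (fun k => a k * b (l - k)).
Proof.
move=> sa sb; have [_ /(_ l)] := synth_mul (synth_cintegrable sb) sa.
under eq_fun do rewrite mulrC; move=> ->.
by apply: csum_eq => k; rewrite (fourier_coef_synth _ sb).
Qed.

(** Both sides have the same Fourier coefficients. *)
Lemma fourier_inversion f K : cintegrable f -> summable_by (fourier_coef f) K ->
  ae_eqT f (synth (fourier_coef f)).
Proof.
move=> cf sf; have cs := synth_cintegrable sf.
have : null_spectrum (fun x => f x - synth (fourier_coef f) x).
  split=> [|l]; first exact: cintegrableB.
  by rewrite fourier_coefB // (fourier_coef_synth _ sf) subrr.
move/null_spectrum_eq0 => [A [mA muA HA]]; exists A; split=> // x /= hx.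
by apply: HA => /= h; apply: hx => /h /eqP; rewrite subr_eq0 => /eqP.
Qed.

Lemma L2T_sqr_cintegrable f : L2T f -> cintegrable (fun x => f x ^+ 2).
Proof.
case=> _ m1 m2 fin.
have ms : measurable_fun TT (fun x => sqmod (f x)).
  by apply: measurable_funD; apply: measurable_funX.
have is_ : (@lebesgue_measure R).-integrable TT (EFin \o (fun x => sqmod (f x))).
  apply/integrableP; split; first exact: measurable_EFin_torus.
  by under eq_integral do rewrite /= ger0_norm ?sqmod_ge0 //; exact: fin.
have [m3 m4] := cmeasurableM (conj m1 m2) (conj m1 m2).
have le1 x : normc (f x ^+ 2) = sqmod (f x) by rewrite sqmodE !expr2 normcM.
split; apply: (le_integrable measurable_torus _ _ is_) => //.
- exact: measurable_EFin_torus.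
- by move=> x _; rewrite lee_fin (le_trans (normc_Re _)) // le1 ler_norm.
- exact: measurable_EFin_torus.
- by move=> x _; rewrite lee_fin (le_trans (normc_Im _)) // le1 ler_norm.
Qed.

(** f agrees almost everywhere with the sum of its Fourier series, and the square
    of an absolutely convergent series has the convolution as coefficients. *)
Lemma fourier_coef_sqr f K l : L2T f -> summable_by (fourier_coef f) K ->
  fourier_coef (fun x => f x ^+ 2) l =
  csum (fun k => fourier_coef f k * fourier_coef f (l - k)).
Proof.
move=> Lf sf; rewrite -(fourier_coef_synthM _ sf sf).
have [A [mA muA HA]] := fourier_inversion (L2T_cintegrable Lf) sf.
apply: fourier_coef_ae; first exact: L2T_sqr_cintegrable.
  by apply: cintegrableM; [exact: synth_cintegrable sf|exact: synth_bmeas sf].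
exists A; split=> // x /= hx; apply: HA => /= h; apply: hx => /h e.
by rewrite expr2 {1 2}e.
Qed.

End FourierSynthesis.

(** * Weighted sequences and the algebra property *)
Section WeightedSequences.
Context {R : realType}.
Implicit Types (a b : int -> R[i]) (K L t : R) (x y : int -> R) (kap : int -> int -> R[i]).

(** Expand the sum of the squares (B x - X y)^2, where X is the sum of x y and B
    that of y^2. *)
Lemma psum_CauchySchwarz N x y :
  psum N (fun l => x l * y l) ^+ 2 <=
  psum N (fun l => x l ^+ 2) * psum N (fun l => y l ^+ 2).
Proof.
set X := psum N (fun l => x l * y l); set A := psum N (fun l => x l ^+ 2).
set B := psum N (fun l => y l ^+ 2).
have B0 : 0 <= B by apply: psum_ge0 => l; exact: sqr_ge0.
have H : 0 <= B * (A * B - X ^+ 2).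
  have -> : B * (A * B - X ^+ 2) = psum N (fun l => (B * x l - X * y l) ^+ 2).
    have -> : (fun l => (B * x l - X * y l) ^+ 2) =
       (fun l => B ^+ 2 * x l ^+ 2 + ((- 2 * B * X) * (x l * y l) + X ^+ 2 * y l ^+ 2)).
      by apply/funext => l; ring.
    by rewrite !psumD !psumZ -/A -/X -/B; ring.
  by apply: psum_ge0 => l; exact: sqr_ge0.
(* For B = 0 the identity says nothing, but then y vanishes. *)
have [B1|B1] := eqVneq B 0; last first.
  have {}B0 : 0 < B by rewrite lt_neqAle eq_sym B1.
  by rewrite -subr_ge0; rewrite pmulr_rge0 in H.
suff -> : X = 0 by rewrite expr0n mulr_ge0 // psum_ge0 // => l; exact: sqr_ge0.
move: B1; rewrite /B /X /psum => /psumr_eq0P => h; apply: big1 => i _.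
have /eqP := h (fun i _ => sqr_ge0 _) i isT.
by rewrite sqrf_eq0 => /eqP ->; rewrite mulr0.
Qed.

Lemma psum_limit (x_ : nat -> int -> R) x K N : (forall n, psum N (x_ n) <= K) ->
  (forall l, (fun n => x_ n l) @ \oo --> x l) -> psum N x <= K.
Proof.
move=> hK hx; have H : (fun n => psum N (x_ n)) @ \oo --> psum N x.
  rewrite /psum; apply: cvg_big => //; exact: add_continuous.
by apply: (cvgr_to_le H); exact: nearW.
Qed.

Variable r : R.
Hypothesis hr : 1 / 2 < r.

Definition weight (l : int) : R := (1 + l%:~R ^+ 2) `^ r.

Lemma wt_base (l : int) : 1 <= 1 + (l%:~R : R) ^+ 2.
Proof. by rewrite lerDl sqr_ge0. Qed.

Lemma wt_ge1 l : 1 <= weight l.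
Proof.
rewrite /weight -[leLHS](powRr0 (1 + (l%:~R : R) ^+ 2)).
apply: ler_powR; [exact: wt_base|have := hr; lra].
Qed.

Lemma wt_gt0 l : 0 < weight l.
Proof. exact: lt_le_trans ltr01 (wt_ge1 l). Qed.
Hint Resolve wt_gt0 : core.

Lemma wt_ge0 l : 0 <= weight l.
Proof. exact: ltW. Qed.
Hint Resolve wt_ge0 : core.

(** (k + l)^2 <= 2 k^2 + 2 l^2, so 1 + (k + l)^2 is at most four times the larger
    of 1 + k^2 and 1 + l^2. *)
Lemma wt_split k l : weight (k + l) <= 4 `^ r * (weight k + weight l).
Proof.
have r0 : 0 <= r by have := hr; lra.
wlog kl : k l / (k%:~R : R) ^+ 2 <= l%:~R ^+ 2.
  move=> h; case: (leP ((k%:~R : R) ^+ 2) (l%:~R ^+ 2)) => [/h//|/ltW/h].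
  by rewrite addrC [weight l + _]addrC.
apply: (@le_trans _ _ (4 `^ r * weight l)); last first.
  by rewrite ler_wpM2l ?powR_ge0 // lerDr.
rewrite /weight -powRM //; last by apply: le_trans (wt_base l).
apply: ge0_ler_powR => //; rewrite ?nnegrE.
- exact: le_trans ler01 (wt_base _).
- by rewrite mulr_ge0 // (le_trans ler01) // wt_base.
by rewrite intrD; have := sqr_ge0 ((k%:~R : R) - l%:~R); nra.
Qed.

(** The weight at n + 2 is at least (n + 2)^(2r), and with q = 2 r - 1 > 0
    n^-q decreases from n + 1 to n + 2 by at least q (n + 2)^(-2r): use
    exp(q d) >= 1 + q d with
    d = ln ((n + 2) / (n + 1)) >= 1 / (n + 2). This is where r > 1/2 enters. *)
Lemma wt_inv_telescope (n : nat) : (weight n.+2%:Z)^-1 <=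
  (2 * r - 1)^-1 * (expR (- (2 * r - 1) * ln n.+1%:R) - expR (- (2 * r - 1) * ln n.+2%:R)).
Proof.
set q := 2 * r - 1; have q0 : 0 < q by rewrite /q; have := hr; lra.
have n1 : (0 : R) < n.+1%:R by rewrite ltr0n.
have n2 : (0 : R) < n.+2%:R by rewrite ltr0n.
set A := ln n.+1%:R; set B := ln n.+2%:R.
have BA : (n.+2%:R)^-1 <= B - A.
  have e : n.+1%:R / n.+2%:R = 1 + - (n.+2%:R)^-1 :> R.
    by rewrite -[n.+2]addn1 natrD; field; rewrite -natr1 in n2; lra.
  have : ln (1 + - (n.+2%:R)^-1) <= - (n.+2%:R)^-1 :> R.
    apply: le_ln1Dx; rewrite ltrN2 invf_lt1 // ltr1n //.
  by rewrite -e ln_div ?posrE // -/A -/B => h; rewrite -lerN2 opprB.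
have w1 : (weight n.+2%:Z)^-1 <= expR (- q * B) / n.+2%:R.
  have -> : expR (- q * B) / n.+2%:R = expR (- (2 * r * B)).
    rewrite -[X in _ / X](@lnK _ n.+2%:R) ?posrE // -/B -expRN -expRD; congr expR.
    by rewrite /q; ring.
  rewrite expRN lef_pV2 ?posrE ?expR_gt0 // /weight /powR gt_eqF; last first.
    exact: lt_le_trans ltr01 (wt_base _).
  have -> : 2 * r * B = r * (2 * B) by ring.
  rewrite ler_expR ler_pM2l; last by have := hr; lra.
  have -> : 2 * B = ln (n.+2%:R ^+ 2) by rewrite lnXn // mulr_natl.
  rewrite ler_ln ?posrE ?exprn_gt0 ?(lt_le_trans ltr01 (wt_base _)) //.
  by rewrite lerDr.
apply: le_trans w1 _.
have -> : expR (- q * A) = expR (- q * B) * expR (q * (B - A)).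
  by rewrite -expRD; congr expR; ring.
have E : 1 + q * (B - A) <= expR (q * (B - A)) by exact: expR_ge1Dx.
rewrite ler_pdivlMl // -[X in _ <= _ - X]mulr1 -mulrBr mulrCA ler_pM2l ?expR_gt0 //.
apply: (@le_trans _ _ (q * (B - A))); last by lra.
by rewrite ler_pM2l.
Qed.

Lemma wtN l : weight (- l) = weight l.
Proof. by rewrite /weight mulrNz sqrrN. Qed.

Lemma wt_inv_summable : exists2 S : R, 0 < S & forall N, psum N (fun l => (weight l)^-1) <= S.
Proof.
pose q := 2 * r - 1; have q0 : 0 < q by rewrite /q; have := hr; lra.
have q1 : 0 < 2 * q^-1 by rewrite mulr_gt0 // invr_gt0.
pose u n := 3 + 2 * q^-1 * (expR (- q * ln 1) - expR (- q * ln n.+1%:R)).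
have P0 : psum 1 (fun l => (weight l)^-1) <= 3.
  have w l : (weight l)^-1 <= 1 by rewrite invf_le1 // wt_ge1.
  by rewrite psumS psum0; have := w 0; have := w 1%:Z; have := w (- 1%:Z); lra.
have H N : psum N.+1 (fun l => (weight l)^-1) <= u N.
  elim: N => [|N IH]; first by rewrite /u subrr mulr0 addr0.
  rewrite psumS wtN; have := wt_inv_telescope N; rewrite /= -/q => h.
  by move: IH; rewrite /u; nra.
exists (3 + 2 * q^-1) => [|N]; first by lra.
apply: le_trans (psum_homo _ (leqnSn N)) _; first by move=> l; rewrite invr_ge0.
apply: le_trans (H N) _; rewrite /u ln1 mulr0 expR0 lerD2l.
by rewrite -[leRHS]mulr1 ler_pM2l // lerBlDr lerDl expR_ge0.
Qed.

(** K bounds the H^r norm of the sequence. Stated on partial sums of squares, the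
    bound passes to limits of sequences taken mode by mode. *)
Definition wbound a K := 0 <= K /\ forall N, psum N (fun l => weight l * sqmod (a l)) <= K ^+ 2.

Lemma weighted_sqmod_ge0 a l : 0 <= weight l * sqmod (a l).
Proof. by rewrite mulr_ge0 // sqmod_ge0. Qed.

Lemma wbound_le a K L : K <= L -> wbound a K -> wbound a L.
Proof.
move=> KL [K0 h]; have L0 := le_trans K0 KL; split=> // N.
by apply: le_trans (h N) _; rewrite lerXn2r.
Qed.

Lemma wbound_dom a b K : (forall l, normc (b l) <= normc (a l)) -> wbound a K -> wbound b K.
Proof.
move=> ba [K0 h]; split=> // N; apply: le_trans (h N); apply: ler_psum => l.
by rewrite ler_pM2l // !sqmodE lerXn2r ?nnegrE ?normc_ge0.
Qed.

Lemma wboundZ (c : R[i]) a K : wbound a K -> wbound (fun l => c * a l) (normc c * K).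
Proof.
move=> [K0 h]; split=> [|N]; first by rewrite mulr_ge0 ?normc_ge0.
have -> : (fun l => weight l * sqmod (c * a l)) = (fun l => normc c ^+ 2 * (weight l * sqmod (a l))).
  by apply/funext => l; rewrite !sqmodE normcM; ring.
by rewrite psumZ exprMn ler_wpM2l ?sqr_ge0.
Qed.

Lemma wbound0 : wbound (fun=> 0) 0.
Proof.
split=> // N; rewrite /psum big1 ?sqr_ge0 // => i _.
by rewrite sqmodE normc0 expr0n mulr0.
Qed.

(** Minkowski's inequality: the cross term is bounded by Cauchy-Schwarz. *)
Lemma wboundD a b K L : wbound a K -> wbound b L -> wbound (fun l => a l + b l) (K + L).
Proof.
move=> [K0 ha] [L0 hb]; split=> [|N]; first exact: addr_ge0.
pose X := psum N (fun l => (Num.sqrt (weight l) * normc (a l)) * (Num.sqrt (weight l) * normc (b l))).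
have sq c : psum N (fun l => (Num.sqrt (weight l) * normc (c l)) ^+ 2) = psum N (fun l => weight l * sqmod (c l)).
  by congr (psum N); apply/funext => l; rewrite exprMn sqr_sqrtr // sqmodE.
have XKL : X <= K * L.
  rewrite -ler_sqr ?nnegrE ?mulr_ge0 //; last first.
    by apply: psum_ge0 => l; rewrite !mulr_ge0 ?sqrtr_ge0 ?normc_ge0.
  apply: le_trans (psum_CauchySchwarz _ _ _) _; rewrite !sq exprMn ler_pM //;
    by apply: psum_ge0 => l; exact: weighted_sqmod_ge0.
apply: (@le_trans _ _ (psum N (fun l => weight l * sqmod (a l)) + (2 * X + psum N (fun l => weight l * sqmod (b l))))).
  rewrite /X -psumZ -!psumD; apply: ler_psum => l.
  have -> : 2 * (Num.sqrt (weight l) * normc (a l) * (Num.sqrt (weight l) * normc (b l))) =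
     weight l * (2 * normc (a l) * normc (b l)).
    by rewrite -{3}(sqr_sqrtr (wt_ge0 l)); ring.
  rewrite -!mulrDr ler_pM2l // !sqmodE.
  have := normcD (a l) (b l); have := normc_ge0 (a l); have := normc_ge0 (b l).
  by have := normc_ge0 (a l + b l); nra.
by have := ha N; have := hb N; nra.
Qed.

Lemma wboundB a b K L : wbound a K -> wbound b L -> wbound (fun l => a l - b l) (K + L).
Proof.
move=> ha hb; apply: wboundD => //; apply: wbound_dom hb => l.
by rewrite normcN.
Qed.

Lemma wbound_sum (I : Type) (s : seq I) (F : I -> int -> R[i]) (K : I -> R) :
  (forall i, wbound (F i) (K i)) -> wbound (fun l => \sum_(i <- s) F i l) (\sum_(i <- s) K i).
Proof.
move=> h; elim: s => [|i s IH].
  by under eq_fun do rewrite big_nil; rewrite big_nil; exact: wbound0.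
by under eq_fun do rewrite big_cons; rewrite big_cons; exact: wboundD.
Qed.

(** Fatou's lemma: each partial sum of squares involves finitely many modes. *)
Lemma wbound_lim (x : nat -> int -> R[i]) (z : int -> R[i]) K :
  (forall n, wbound (x n) K) -> (forall l, ctends (x ^~ l) (z l)) -> wbound z K.
Proof.
move=> hx xz; have [K0 _] := hx 0%N; split=> // N.
apply: (psum_limit (x_ := fun n l => weight l * sqmod (x n l))).
  by move=> n; have [] := hx n.
move=> l; apply: cvgM; first exact: cvg_cst.
rewrite sqmodE; under eq_fun do rewrite sqmodE.
have h := ctends_normc (xz l); rewrite expr2; under eq_fun do rewrite expr2.
exact: cvgM.
Qed.

(** |z| <= 1 / u + u |z|^2 for u > 0; take for u the weight, whose inverse is
    summable. *)
Lemma wbound_summable : exists2 S : R, 0 < S &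
  forall a K, wbound a K -> summable_by a (S + K ^+ 2).
Proof.
have [S S0 hS] := wt_inv_summable; exists S => // a K [K0 ha] N.
apply: (@le_trans _ _ (psum N (fun l => (weight l)^-1 + weight l * sqmod (a l)))).
  apply: ler_psum => l; rewrite sqmodE.
  have w0 := wt_gt0 l; set w := weight l in w0 *; set y := normc _.
  have -> : w^-1 + w * y ^+ 2 = w^-1 * (1 + (w * y) ^+ 2) by field; rewrite gt_eqF.
  have z0 : 0 <= w * y by rewrite mulr_ge0 ?normc_ge0 // ltW.
  by rewrite ler_pdivlMl //; have := sqr_ge0 (w * y - 1); nra.
by rewrite psumD lerD.
Qed.

(** Every quadratic term of the problem has this form: the product of two
    functions with kap = 1, and the step of the integrator with an oscillating
    kap. *)
Definition bilin (kap : int -> int -> R[i]) a b (l : int) : R[i] :=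
  csum (fun k => kap l k * a k * b (l - k)).

Lemma bilin_summand_le kap t a b l k : (forall l k, normc (kap l k) <= t) ->
  normc (kap l k * a k * b (l - k)) <= t * (weight k * sqmod (a k) + weight (l - k) * sqmod (b (l - k))).
Proof.
move=> ht; rewrite !normcM !sqmodE -mulrA; apply: ler_pM => //; rewrite ?mulr_ge0 ?normc_ge0 //.
set x := normc (a k); set y := normc (b (l - k)).
have := wt_ge1 k; have := wt_ge1 (l - k); have := sqr_ge0 x; have := sqr_ge0 y.
have := sqr_ge0 (x - y); set u := weight k; set v := weight (l - k); nra.
Qed.

Lemma psum_sym y K l N : (forall l, 0 <= y l) -> (forall N, psum N y <= K) ->
  psum N (fun k => y (l - k)) <= K.
Proof. by move=> y0 hK; apply: (psum_comp (f := fun k => l - k)) => // i j /addrI /oppr_inj. Qed.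

Lemma bilin_dominated kap t a b K L l : (forall l k, normc (kap l k) <= t) ->
  wbound a K -> wbound b L ->
  forall N, psum N (fun k => t * (weight k * sqmod (a k) + weight (l - k) * sqmod (b (l - k))))
    <= t * (K ^+ 2 + L ^+ 2).
Proof.
move=> ht [K0 ha] [L0 hb] N; have t0 : 0 <= t := le_trans (normc_ge0 _) (ht 0 0).
rewrite psumZ ler_wpM2l // psumD lerD //.
by apply: (psum_sym (y := fun l => weight l * sqmod (b l))) => // k; exact: weighted_sqmod_ge0.
Qed.

Lemma bilin_summable kap t a b K L l : (forall l k, normc (kap l k) <= t) ->
  wbound a K -> wbound b L ->
  summable_by (fun k => kap l k * a k * b (l - k)) (t * (K ^+ 2 + L ^+ 2)).
Proof.
move=> ht ha hb N; apply: le_trans (bilin_dominated l ht ha hb N).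
by apply: ler_psum => k; exact: bilin_summand_le.
Qed.

(** H^r is an algebra, with a constant that depends on kap through its sup norm
    only, so oscillating kernels cost nothing. Cauchy-Schwarz with the factor
    1 / (weight k * weight (l - k)) bounds mode l: times the weight of l, this
    factor is by [wt_split] at most 4^r times the sum of the two inverse weights,
    hence summable in k with a bound independent of l. What remains is a
    convolution of two summable sequences. *)
Lemma bilin_wbound : exists2 C : R, 0 < C & forall kap t a b K L,
  (forall l k, normc (kap l k) <= t) -> wbound a K -> wbound b L ->
  wbound (bilin kap a b) (t * C * K * L).
Proof.
have [S S0 hS] := wt_inv_summable.
have c0 : 0 < 4 `^ r * (2 * S) by rewrite mulr_gt0 ?powR_gt0 ?mulr_gt0.
exists (Num.sqrt (4 `^ r * (2 * S))); first by rewrite sqrtr_gt0.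
move=> kap t a b K L ht ha hb; have t0 : 0 <= t := le_trans (normc_ge0 _) (ht 0 0).
have [K0 hA] := ha; have [L0 hB] := hb.
(* Work with finite sums over k, uniformly in their length M. *)
apply: (wbound_lim (x := fun M l => psum M (fun k => kap l k * a k * b (l - k)))); last first.
  by move=> l; exact: summable_by_cvg (bilin_summable l ht ha hb).
move=> M; split=> [|N]; first by rewrite !mulr_ge0 ?sqrtr_ge0.
have -> : (t * Num.sqrt (4 `^ r * (2 * S)) * K * L) ^+ 2 =
    t ^+ 2 * (4 `^ r * (2 * S)) * (K ^+ 2 * L ^+ 2).
  by rewrite !exprMn sqr_sqrtr ?ltW //; ring.
pose P k := weight k * sqmod (a k); pose Q k := weight k * sqmod (b k).
have P0 k : 0 <= P k by exact: weighted_sqmod_ge0.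
have Q0 k : 0 <= Q k by exact: weighted_sqmod_ge0.
have key l : weight l * sqmod (psum M (fun k => kap l k * a k * b (l - k))) <=
    t ^+ 2 * (4 `^ r * (2 * S)) * psum M (fun k => P k * Q (l - k)).
  pose om k := (weight k * weight (l - k))^-1.
  have om0 k : 0 <= om k by rewrite invr_ge0 mulr_ge0.
  have h1 : normc (psum M (fun k => kap l k * a k * b (l - k))) <=
     t * psum M (fun k => Num.sqrt (om k) * Num.sqrt (P k * Q (l - k))).
    apply: le_trans (normc_psum _ _) _; rewrite -psumZ; apply: ler_psum => k.
    rewrite !normcM -mulrA ler_pM ?mulr_ge0 ?normc_ge0 // -sqrtrM //.
    have -> : om k * (P k * Q (l - k)) = (normc (a k) * normc (b (l - k))) ^+ 2.
      by rewrite /om /P /Q !sqmodE; field; rewrite !gt_eqF.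
    by rewrite sqrtr_sqr ger0_norm // mulr_ge0 ?normc_ge0.
  have h2 : sqmod (psum M (fun k => kap l k * a k * b (l - k))) <=
     t ^+ 2 * (psum M om * psum M (fun k => P k * Q (l - k))).
    rewrite sqmodE; apply: (@le_trans _ _ ((t * psum M (fun k => Num.sqrt (om k) * Num.sqrt (P k * Q (l - k)))) ^+ 2)).
      by rewrite lerXn2r ?nnegrE ?normc_ge0 // (le_trans _ h1) ?normc_ge0.
    rewrite exprMn ler_wpM2l ?sqr_ge0 //; apply: le_trans (psum_CauchySchwarz _ _ _) _.
    have sq (z : int -> R) : (forall k, 0 <= z k) ->
        psum M (fun k => Num.sqrt (z k) ^+ 2) = psum M z.
      by move=> z0; congr (psum M); apply/funext => k; rewrite sqr_sqrtr.
    by rewrite !sq // => k; exact: mulr_ge0.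
  have h3 : weight l * psum M om <= 4 `^ r * (2 * S).
    rewrite -psumZ; apply: (@le_trans _ _ (psum M (fun k => 4 `^ r * ((weight (l - k))^-1 + (weight k)^-1)))).
      apply: ler_psum => k; rewrite /om.
      have -> : (weight (l - k))^-1 + (weight k)^-1 = (weight k + weight (l - k)) * (weight k * weight (l - k))^-1.
        by field; rewrite !gt_eqF.
      rewrite mulrA; apply: ler_wpM2r; first exact: om0.
      by have := wt_split k (l - k); rewrite [k + _]addrC subrK.
    rewrite psumZ ler_wpM2l ?powR_ge0 // psumD mulr2n mulrDl mul1r lerD //.
    by apply: (psum_sym (y := fun k => (weight k)^-1)) => // k; rewrite invr_ge0.
  have PQ0 : 0 <= psum M (fun k => P k * Q (l - k)) by apply: psum_ge0 => k; exact: mulr_ge0.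
  apply: le_trans (ler_wpM2l (wt_ge0 l) h2) _.
  rewrite mulrCA -[leRHS]mulrA; apply: ler_wpM2l; first exact: sqr_ge0.
  by rewrite [leLHS]mulrA; apply: ler_wpM2r.
apply: le_trans (ler_psum _ key) _; rewrite psumZ ler_wpM2l; last first.
- rewrite psum_exchange; apply: (@le_trans _ _ (psum M (fun k => L ^+ 2 * P k))).
    apply: ler_psum => k; rewrite psumZ mulrC ler_wpM2r //.
    apply: (psum_comp (f := fun l => l - k)) => //; exact: addIr.
  by rewrite psumZ mulrC ler_wpM2r ?sqr_ge0.
- by rewrite mulr_ge0 ?sqr_ge0 // ltW.
by [].
Qed.

Lemma bilinDl kap t a1 a2 b K1 K2 L l : (forall l k, normc (kap l k) <= t) ->
  wbound a1 K1 -> wbound a2 K2 -> wbound b L ->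
  bilin kap (fun k => a1 k + a2 k) b l = bilin kap a1 b l + bilin kap a2 b l.
Proof.
move=> ht h1 h2 hb.
rewrite /bilin -(csumD (bilin_summable l ht h1 hb) (bilin_summable l ht h2 hb)).
by apply: csum_eq => k; ring.
Qed.

Lemma bilinDr kap t a b1 b2 K L1 L2 l : (forall l k, normc (kap l k) <= t) ->
  wbound a K -> wbound b1 L1 -> wbound b2 L2 ->
  bilin kap a (fun k => b1 k + b2 k) l = bilin kap a b1 l + bilin kap a b2 l.
Proof.
move=> ht ha h1 h2.
rewrite /bilin -(csumD (bilin_summable l ht ha h1) (bilin_summable l ht ha h2)).
by apply: csum_eq => k; ring.
Qed.

Lemma bilin_diff kap t a b K L : (forall l k, normc (kap l k) <= t) ->
  wbound a K -> wbound b L -> forall l,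
  bilin kap a a l - bilin kap b b l =
  bilin kap (fun k => a k - b k) a l + bilin kap b (fun k => a k - b k) l.
Proof.
move=> ht ha hb l; have hab := wboundB ha hb.
rewrite -{1}(_ : (fun k => (a k - b k) + b k) = a); last by apply/funext => k; rewrite subrK.
rewrite (bilinDl _ ht hab hb ha).
rewrite -{3}(_ : (fun k => (a k - b k) + b k) = a); last by apply/funext => k; rewrite subrK.
by rewrite (bilinDr _ ht hb hab hb); ring.
Qed.

Lemma sobolev_normP (f : R -> R[i]) K : 0 <= K ->
  (sobolev_norm r f <= K%:E)%E <-> wbound (fourier_coef f) K.
Proof.
move=> K0; rewrite /sobolev_norm.
have -> : K%:E = sqrte ((K ^+ 2)%:E) by rewrite /sqrte sqrtr_sqr ger0_norm.
rewrite lee_sqrt ?lee_fin ?sqr_ge0 //.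
have -> : (\esum_(l in [set: int]) ((1 + l%:~R ^+ 2) `^ r * sqmod (fourier_coef f l))%:E)%E =
  (\esum_(l in [set: int]) (weight l * sqmod (fourier_coef f l))%:E)%E by [].
rewrite esum_psum_le; last exact: weighted_sqmod_ge0.
by split=> [h|[]].
Qed.

Lemma sobolev_norm_fin (f : R -> R[i]) : (sobolev_norm r f < +oo)%E ->
  exists K, wbound (fourier_coef f) K.
Proof.
move=> h; have h0 : (0 <= sobolev_norm r f)%E by exact: sqrte_ge0.
exists (fine (sobolev_norm r f)); apply/sobolev_normP; first exact: fine_ge0.
by rewrite fineK // ge0_fin_numE.
Qed.

End WeightedSequences.

(** * Integrals of exponentials and their Riemann sums *)
Section OscillatoryIntegrals.
Context {R : realType}.
Implicit Types (x y s t d alpha : R).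

Lemma derive_bound (f f' : R -> R) (K : R) (x : R) : (forall z : R, is_derive z (1 : R) f (f' z)) ->
  (forall z, `|z| <= `|x| -> `|f' z| <= K) -> `|f x - f 0| <= K * `|x|.
Proof.
move=> df bf.
have cf : continuous f by move=> z; exact/differentiable_continuous/derivable1_diffP.
have [x0|x0|<-] := ltgtP 0 x; last by rewrite subrr !normr0 mulr0.
  have [c cx ->] := @MVT _ f f' 0 x x0 (fun z _ => df z) (continuous_subspaceT cf).
  rewrite subr0 normrM ler_wpM2r // bf //; move: cx; rewrite in_itv /= => /andP[c0 c1].
  by rewrite !ger0_norm ltW.
have [c cx] := @MVT _ f f' x 0 x0 (fun z _ => df z) (continuous_subspaceT cf).
rewrite distrC => ->; rewrite sub0r normrM normrN ler_wpM2r // bf //.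
move: cx; rewrite in_itv /= => /andP[c0 c1].
by rewrite !ler0_norm ?lerN2 ltW.
Qed.

Lemma normr_sin_le x : `|sin x| <= `|x|.
Proof.
have := @derive_bound sin cos 1 x (fun z => is_derive_sin z) (fun z _ => cos_max z).
by rewrite sin0 subr0 mul1r.
Qed.

Lemma cos_sub1_le x : `|cos x - 1| <= x ^+ 2.
Proof.
have := @derive_bound cos (fun z => - sin z) `|x| x (fun z => is_derive_cos z).
rewrite cos0 -[x ^+ 2]real_normK ?num_real // expr2; apply=> z zx.
by rewrite normrN; apply: le_trans (normr_sin_le z) zx.
Qed.

(** The derivative cos z - 1 is at most x^2 in modulus between 0 and x. *)
Lemma sin_subid_le x : `|sin x - x| <= `|x| * x ^+ 2.
Proof.
have D (z : R) : is_derive z (1 : R) (fun y => sin y - y) (cos z - 1).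
  by apply: is_derive_eq.
have := @derive_bound _ _ (x ^+ 2) x D; rewrite sin0 subrr subr0 mulrC; apply=> z zx.
apply: le_trans (cos_sub1_le z) _.
by rewrite -[z ^+ 2]real_normK ?num_real // -[x ^+ 2]real_normK ?num_real // lerXn2r ?nnegrE.
Qed.

Lemma normc_expi_sub1 x : normc (expi x - 1) <= `|x|.
Proof.
rewrite -ler_sqr ?nnegrE ?normc_ge0 // -sqmodE /sqmod /= subr0.
have -> : (cos x - 1) ^+ 2 + sin x ^+ 2 = 2 * (1 - cos x).
  have := cos2Dsin2 x; set c := cos x; set s := sin x => h.
  have -> : s ^+ 2 = 1 - c ^+ 2 by rewrite -h; ring.
  by ring.
pose y := x / 2; have -> : x = y *+ 2 by rewrite /y -mulr_natr; field.
have hs : sin y ^+ 2 <= y ^+ 2.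
  rewrite -[leLHS]real_normK ?num_real // -[leRHS]real_normK ?num_real //.
  by rewrite ler_sqr ?nnegrE //; exact: normr_sin_le.
have hc := cos2Dsin2 y.
rewrite cos_mulr2n real_normK ?num_real //.
have -> : (y *+ 2) ^+ 2 = 4 * y ^+ 2 by ring.
have -> : 2 * (1 - (cos y ^+ 2 *+ 2 - 1)) = 4 * (1 - cos y ^+ 2) by ring.
by lra.
Qed.

(** The integral of exp(i alpha u) over [0, s], in closed form. *)
Definition expint alpha s : R[i] :=
  if alpha == 0 then s%:C%C else (expi (alpha * s) - 1) / ('i%C * alpha%:C%C).

Lemma i_alpha_neq0 alpha : alpha != 0 -> ('i%C * alpha%:C%C) != 0 :> R[i].
Proof.
move=> a0; apply/eqP => /(congr1 (@normc R)); rewrite normcM normc_i normc_real normc0 mul1r.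
by move/eqP; rewrite normr_eq0 (negPf a0).
Qed.

Lemma expint0 alpha : expint alpha 0 = 0.
Proof. by rewrite /expint; case: ifP => _ //; rewrite mulr0 expi0 subrr mul0r. Qed.

Lemma expintD alpha s d :
  expint alpha (s + d) = expint alpha s + expi (alpha * s) * expint alpha d.
Proof.
rewrite /expint; case: eqVneq => [->|a0]; first by rewrite mul0r expi0 mul1r rmorphD.
have := i_alpha_neq0 a0; set z := _ * _ => z0.
by rewrite mulrDr expiD; field.
Qed.

Lemma normc_expint alpha s : normc (expint alpha s) <= `|s|.
Proof.
rewrite /expint; case: eqVneq => [_|a0]; first by rewrite normc_real.
rewrite normcM normcV normcM normc_i mul1r normc_real ler_pdivrMr ?normr_gt0 //.
by apply: le_trans (normc_expi_sub1 _) _; rewrite normrM mulrC.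
Qed.

Lemma expint_consistency alpha d : normc (expint alpha d - d%:C%C) <= `|alpha| * (1 + `|alpha * d|) * d ^+ 2.
Proof.
rewrite /expint; case: eqVneq => [->|a0]; first by rewrite subrr normc0 normr0 !mul0r.
have -> : (expi (alpha * d) - 1) / ('i%C * alpha%:C%C) - d%:C%C =
   (expi (alpha * d) - 1 - ('i%C * alpha%:C%C * d%:C%C)) / ('i%C * alpha%:C%C).
  by have := i_alpha_neq0 a0; set z := ('i%C * alpha%:C%C) => z0; field.
rewrite normcM normcV normcM normc_i mul1r normc_real ler_pdivrMr ?normr_gt0 //.
apply: le_trans (normc_le_ReIm _) _.
rewrite !(cReD, cImD, cReN, cImN, cReM, cImM) /= !(mul0r, mulr0, mul1r, subr0, add0r, addr0, oppr0).
apply: le_trans (lerD (cos_sub1_le _) (sin_subid_le _)) _.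
have -> : `|alpha| * (1 + `|alpha * d|) * d ^+ 2 * `|alpha| = `|alpha| ^+ 2 * d ^+ 2 * (1 + `|alpha * d|) by ring.
by rewrite real_normK ?num_real // -exprMn; lra.
Qed.

(** By [expintD] the integral is the sum of expint alpha d, d = s / (n + 1),
    transported to each node, and expint alpha d differs from d by O(d^2). *)
Lemma expint_riemann_sum alpha s : 
  ctends (fun n => \sum_(j < n.+1) (s / n.+1%:R)%:C%C * expi (alpha * (s * j%:R / n.+1%:R)))
         (expint alpha s).
Proof.
pose K := `|alpha| * (1 + `|alpha * s|) * s ^+ 2.
have K0 : 0 <= K.
  by apply: mulr_ge0; [apply: mulr_ge0 => //; exact: addr_ge0|exact: sqr_ge0].
apply/ctendsP => e e0.
have [N hN] := inv_succ_small K e0.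
exists N => n /hN; apply: le_lt_trans.
have n0 : (0 : R) < n.+1%:R by rewrite ltr0n.
set d := s / n.+1%:R.
have tele m : expint alpha (d * m%:R) = \sum_(j < m) expi (alpha * (d * j%:R)) * expint alpha d.
  elim: m => [|m IH]; first by rewrite mulr0 expint0 big_ord0.
  by rewrite -natr1 mulrDr mulr1 expintD IH big_ord_recr.
have -> : expint alpha s = \sum_(j < n.+1) expi (alpha * (d * j%:R)) * expint alpha d.
  by rewrite -tele; congr expint; rewrite /d divfK // gt_eqF.
rewrite -sumrB; apply: le_trans (normc_sum _ _ _) _.
apply: (@le_trans _ _ (\sum_(j < n.+1) K / n.+1%:R ^+ 2)); last first.
  by rewrite sumr_const card_ord -[leLHS]mulr_natr expr2 invfM mulrA divfK // gt_eqF.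
apply: ler_sum => j _.
have -> : s * j%:R / n.+1%:R = d * j%:R by rewrite /d; ring.
rewrite mulrC -mulrBr normcM normc_expi mul1r normc_distC.
apply: le_trans (expint_consistency _ _) _.
have -> : K / n.+1%:R ^+ 2 = `|alpha| * (1 + `|alpha * s|) * d ^+ 2.
  by rewrite /K /d exprMn exprVn; ring.
rewrite ler_wpM2r ?sqr_ge0 // ler_wpM2l // lerD2l /d mulrA normrM ler_piMr //.
by rewrite ger0_norm ?invr_ge0 ?ler0n // invf_le1 // ler1n.
Qed.

End OscillatoryIntegrals.

(** * Local error and stability on sequences *)
Section Integrator.
Context {R : realType}.
Implicit Types (s t tau eps : R) (a b v : int -> R[i]) (l k : int) (K L M : R).

(** The symbol of the free flow [schrodinger]. *)
Definition phase t l : R[i] := expi (- (t * l%:~R ^+ 2)).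

Lemma phaseD s t l : phase (s + t) l = phase s l * phase t l.
Proof. by rewrite /phase mulrDl opprD expiD. Qed.

Lemma normc_phase t l : normc (phase t l) = 1.
Proof. exact: normc_expi. Qed.

Lemma phase0 l : phase 0 l = 1.
Proof. by rewrite /phase mul0r oppr0 expi0. Qed.

Definition evol t a l : R[i] := phase t l * a l.

Definition convol := bilin (fun _ _ => 1 : R[i]).

(** l^2 - k^2 - (l - k)^2: the frequency that remains when the free flow acts on
    the modes k and l - k and is undone on mode l. *)
Definition resonance l k : R := 2 * k%:~R * (l - k)%:~R.

(** The integral over s in [0, tau] of the phases in the Duhamel term when both
    factors follow the free flow; see [phase_resonance]. *)
Definition kern tau l k : R[i] := phase tau l * expint (resonance l k) tau.

Lemma normc_kern tau l k : normc (kern tau l k) <= `|tau|.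
Proof. by rewrite normcM normc_phase mul1r normc_expint. Qed.

Lemma normc_cst1 (l k : int) : normc (1 : R[i]) <= 1.
Proof. by rewrite normc1. Qed.

Lemma phase_resonance s t l k :
  phase (t - s) l * phase s k * phase s (l - k) = phase t l * expi (resonance l k * s).
Proof.
rewrite /phase -!expiD /resonance; congr expi; rewrite intrB; ring.
Qed.

(** The step of the integrator on Fourier coefficients; [lri_step_hat] identifies
    it with [lri_step]. *)
Definition lri_seq eps tau a l : R[i] :=
  phase tau l * a l - 'i%C * eps%:C%C * bilin (kern tau) a a l.

Variable r : R.
Hypothesis hr : 1 / 2 < r.
Notation hb := (wbound r).

Lemma wbound_evol t a K : hb a K -> hb (evol t a) K.
Proof. by apply: wbound_dom => // l; rewrite /evol normcM normc_phase mul1r. Qed.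

(** With both factors transported freely, every pair of modes contributes an
    exponential, whose Riemann sums converge to [kern]. The sum over the pairs
    and the limit commute since all these Riemann sums are bounded by s. *)
Lemma quadrature v M s l : 0 <= s -> hb v M ->
  ctends (fun n => \sum_(j < n.+1) (s / n.+1%:R)%:C%C *
     (phase (s - s * j%:R / n.+1%:R) l *
      convol (evol (s * j%:R / n.+1%:R) v) (evol (s * j%:R / n.+1%:R) v) l))
    (bilin (kern s) v v l).
Proof.
move=> s0 hv.
pose x n k := (phase s l * \sum_(j < n.+1) (s / n.+1%:R)%:C%C *
   expi (resonance l k * (s * j%:R / n.+1%:R))) * v k * v (l - k).
have xb n k : normc (phase s l * \sum_(j < n.+1) (s / n.+1%:R)%:C%C *
   expi (resonance l k * (s * j%:R / n.+1%:R))) <= s.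
  rewrite normcM normc_phase mul1r; apply: le_trans (normc_sum _ _ _) _.
  under eq_bigr do rewrite normcM normc_expi mulr1 normc_real ger0_norm ?divr_ge0 //.
  by rewrite sumr_const card_ord -[leLHS]mulr_natr divfK // pnatr_eq0.
have E n : \sum_(j < n.+1) (s / n.+1%:R)%:C%C *
     (phase (s - s * j%:R / n.+1%:R) l *
      convol (evol (s * j%:R / n.+1%:R) v) (evol (s * j%:R / n.+1%:R) v) l) = csum (x n).
  pose y (j : 'I_n.+1) k := ((s / n.+1%:R)%:C%C * phase (s - s * j%:R / n.+1%:R) l) *
     (1 * evol (s * j%:R / n.+1%:R) v k * evol (s * j%:R / n.+1%:R) v (l - k)).
  have -> : x n = (fun k => \sum_(j < n.+1) y j k).
    apply/funext => k; rewrite /x mulr_sumr !mulr_suml; apply: eq_bigr => j _.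
    rewrite /y /evol mulrCA -phase_resonance; ring.
  have sc u := bilin_summable hr l normc_cst1 (wbound_evol u hv) (wbound_evol u hv).
  have sy j : summable_by (y j) (s / n.+1%:R * (1 * (M ^+ 2 + M ^+ 2))).
    have := summableZ ((s / n.+1%:R)%:C%C * phase (s - s * j%:R / n.+1%:R) l) (sc (s * j%:R / n.+1%:R)).
    by rewrite normcM normc_phase mulr1 normc_real ger0_norm ?divr_ge0.
  rewrite (csum_sum _ sy); apply: eq_bigr => j _.
  by rewrite mulrA /y (csumZ _ (sc _)).
apply: ctends_eq E _.
apply: (csum_dominated (y := fun k => s * (weight r k * sqmod (v k) + weight r (l - k) * sqmod (v (l - k))))).
- move=> n k; exact: (bilin_summand_le hr (kap := fun _ k => phase s l * \sum_(j < n.+1) (s / n.+1%:R)%:C%C *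
   expi (resonance l k * (s * j%:R / n.+1%:R))) v v l k (fun _ k => xb n k)).
- apply: (bilin_dominated hr (kap := kern s) l _ hv hv) => l' k.
  by apply: le_trans (normc_kern _ _ _) _; rewrite ger0_norm.
- move=> k; rewrite /x; apply: ctendsM; last exact: ctends_cst.
  apply: ctendsM; last exact: ctends_cst.
  by apply: ctendsZ; exact: expint_riemann_sum.
Qed.

(** Duhamel's formula restarted at time t, with the integral kept as a limit of
    left Riemann sums: bounds on the sums pass to the solution by [wbound_lim]. *)
Definition mild_seq eps (S : R) (W : R -> int -> R[i]) :=
  forall t s, 0 <= t -> 0 <= s -> t + s <= S -> forall l,
  ctends (fun n => phase s l * W t l - 'i%C * eps%:C%C *
     \sum_(j < n.+1) (s / n.+1%:R)%:C%C *
       (phase (s - s * j%:R / n.+1%:R) l *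
        convol (W (t + s * j%:R / n.+1%:R)) (W (t + s * j%:R / n.+1%:R)) l))
    (W (t + s) l).

Lemma sumr_part s K n : \sum_(j < n.+1) (s / n.+1%:R * K) = s * K :> R.
Proof. by rewrite sumr_const card_ord -[LHS]mulr_natr mulrAC divfK // pnatr_eq0. Qed.

Lemma normc_ieps eps : 0 <= eps -> normc ('i%C * eps%:C%C : R[i]) = eps.
Proof. by move=> e0; rewrite normcM normc_i mul1r normc_real ger0_norm. Qed.

Lemma wbound_riemann_sum s (F : nat -> int -> R[i]) K n : 0 <= s ->
  (forall j, (j < n.+1)%N -> hb (F j) K) ->
  hb (fun l => \sum_(j < n.+1) (s / n.+1%:R)%:C%C * (phase (s - s * j%:R / n.+1%:R) l * F j l)) (s * K).
Proof.
move=> s0 hF; rewrite -(sumr_part s K n); apply: wbound_sum => // j.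
have -> : s / n.+1%:R * K = normc ((s / n.+1%:R)%:C%C : R[i]) * K.
  by rewrite normc_real ger0_norm // divr_ge0.
by apply: wboundZ; exact: (wbound_evol (s - s * j%:R / n.+1%:R) (hF j (ltn_ord j))).
Qed.

Lemma node_itv s j n : 0 <= s -> (j < n.+1)%N -> 0 <= s * j%:R / n.+1%:R <= s.
Proof.
move=> s0 jn; have n0 : (0 : R) < n.+1%:R by rewrite ltr0n.
rewrite divr_ge0 ?mulr_ge0 //= ler_pdivrMr // ler_wpM2l // ler_nat ltnW //.
Qed.

(** Local error: bounding the Riemann sums of the Duhamel term, the solution
    leaves the free flow by at most eps s C M^2 in time s. Replacing it by the
    free flow in the quadratic term therefore changes the Duhamel integral by at
    most s * 2 C M (eps s C M^2), and by [quadrature] the integral after the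
    replacement is the one that the integrator computes. Stability: the quadratic
    part is bilinear, with norm at most tau C. *)
Lemma one_step_bounds : exists2 C : R, 0 < C &
  (forall eps S M W, 0 <= eps -> mild_seq eps S W ->
     (forall t, 0 <= t <= S -> hb (W t) M) ->
     forall t s, 0 <= t -> 0 <= s -> t + s <= S ->
     hb (fun l => W (t + s) l - lri_seq eps s (W t) l) (2 * C ^+ 2 * M ^+ 3 * (eps * s) ^+ 2)) /\
  (forall eps tau a b K L D, 0 <= eps -> 0 <= tau -> hb a K -> hb b L ->
     hb (fun l => a l - b l) D ->
     hb (fun l => lri_seq eps tau a l - lri_seq eps tau b l) ((1 + C * (K + L) * (eps * tau)) * D)).
Proof.
have [C C0 hC] := bilin_wbound hr; exists C => //; split; last first.
  move=> eps tau a b K L D e0 t0 ha hb_ hd.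
  have hk l k : normc (kern tau l k) <= tau.
    by apply: le_trans (normc_kern _ _ _) _; rewrite ger0_norm.
  have -> : (fun l => lri_seq eps tau a l - lri_seq eps tau b l) = (fun l =>
     evol tau (fun l => a l - b l) l - 'i%C * eps%:C%C *
       (bilin (kern tau) (fun k => a k - b k) a l + bilin (kern tau) b (fun k => a k - b k) l)).
    apply/funext => l; rewrite -(bilin_diff hr hk ha hb_) /lri_seq /evol; ring.
  have -> : (1 + C * (K + L) * (eps * tau)) * D = D + eps * (tau * C * D * K + tau * C * L * D) by ring.
  apply: wboundB => //; first exact: wbound_evol.
  rewrite -{2}(normc_ieps e0); apply: wboundZ; apply: wboundD => //; exact: hC.
move=> eps S M W e0 hW hM.
have M0 t : 0 <= t <= S -> 0 <= M by move=> /hM [].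
have incr t s : 0 <= t -> 0 <= s -> t + s <= S ->
    hb (fun l => W (t + s) l - evol s (W t) l) (eps * (s * (1 * C * M * M))).
  move=> t0 s0 tsS.
  apply: (wbound_lim (x := fun n l => - ('i%C * eps%:C%C) * \sum_(j < n.+1) (s / n.+1%:R)%:C%C *
       (phase (s - s * j%:R / n.+1%:R) l *
        convol (W (t + s * j%:R / n.+1%:R)) (W (t + s * j%:R / n.+1%:R)) l))); last first.
    move=> l; have := ctendsB (hW t s t0 s0 tsS l) (ctends_cst (evol s (W t) l)).
    by apply: ctends_eq => n; rewrite /evol; ring.
  move=> n; rewrite -{2}(normc_ieps e0) -normcN; apply: wboundZ.
  apply: (wbound_riemann_sum (F := fun j => convol (W (t + s * j%:R / n.+1%:R)) (W (t + s * j%:R / n.+1%:R)))) => // j jn.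
  have /andP[j0 j1] := node_itv s0 jn; set u := s * j%:R / n.+1%:R in j0 j1 *.
  by apply: hC; [exact: normc_cst1|apply: hM..]; apply/andP; split; lra.
move=> t s t0 s0 tsS.
have Mt : 0 <= M by apply: (M0 t); apply/andP; split; lra.
have hWt : hb (W t) M by apply: hM; apply/andP; split; lra.
pose d := eps * (s * (1 * C * M * M)).
have d0 : 0 <= d by rewrite !mulr_ge0 // ltW.
have -> : 2 * C ^+ 2 * M ^+ 3 * (eps * s) ^+ 2 = eps * (s * (1 * C * d * M + 1 * C * M * d)).
  by rewrite /d; ring.
apply: (wbound_lim (x := fun n l => - ('i%C * eps%:C%C) * \sum_(j < n.+1) (s / n.+1%:R)%:C%C *
   (phase (s - s * j%:R / n.+1%:R) l *
     (convol (W (t + s * j%:R / n.+1%:R)) (W (t + s * j%:R / n.+1%:R)) l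
      - convol (evol (s * j%:R / n.+1%:R) (W t)) (evol (s * j%:R / n.+1%:R) (W t)) l)))); last first.
  move=> l; have := ctendsB (hW t s t0 s0 tsS l)
    (ctendsB (ctends_cst (phase s l * W t l)) (ctendsZ ('i%C * eps%:C%C) (quadrature l s0 hWt))).
  apply: ctends_eq => n; under eq_bigr do rewrite !mulrBr.
  by rewrite sumrB; ring.
move=> n; rewrite -{2}(normc_ieps e0) -normcN; apply: wboundZ.
apply: (wbound_riemann_sum (F := fun j l => convol (W (t + s * j%:R / n.+1%:R)) (W (t + s * j%:R / n.+1%:R)) l
      - convol (evol (s * j%:R / n.+1%:R) (W t)) (evol (s * j%:R / n.+1%:R) (W t)) l)) => // j jn.
have /andP[j0 j1] := node_itv s0 jn; set u := s * j%:R / n.+1%:R in j0 j1 *.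
have hWu : hb (W (t + u)) M by apply: hM; apply/andP; split; lra.
have hE := wbound_evol u hWt.
have hd : hb (fun k => W (t + u) k - evol u (W t) k) d.
  apply: wbound_le (incr t u t0 j0 _); last lra.
  by rewrite /d ler_wpM2l // ler_wpM2r // !mulr_ge0 // ltW.
have -> : (fun l => convol (W (t + u)) (W (t + u)) l - convol (evol u (W t)) (evol u (W t)) l) = (fun l =>
   convol (fun k => W (t + u) k - evol u (W t) k) (W (t + u)) l +
   convol (evol u (W t)) (fun k => W (t + u) k - evol u (W t) k) l).
  by apply/funext => l; exact: (bilin_diff hr normc_cst1 hWu hE l).
by apply: wboundD => //; apply: hC => //; exact: normc_cst1.
Qed.

End Integrator.

(** * The integrator on Fourier coefficients *)
Section FunctionsAndSequences.
Context {R : realType}.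
Variable r : R.
Hypothesis hr : 1 / 2 < r.
Implicit Types (s t tau eps d : R) (f v phi I : R -> R[i]) (l k : int) (K L M : R).
Notation hb := (wbound r).

(** Fourier coefficients as one sequence, the form in which the estimates of the
    previous parts apply. *)
Definition hat f : int -> R[i] := fourier_coef f.

Lemma schrodinger_synth t f : schrodinger t f = synth (evol t (hat f)).
Proof. by []. Qed.

Definition dx_inv_symbol l : R[i] := if l == 0 then 0 else ('i%C * l%:~R)^-1.

Lemma dx_inv_synth f : dx_inv f = synth (fun l => dx_inv_symbol l * hat f l).
Proof. by []. Qed.

Lemma normc_dx_inv_symbol l : normc (dx_inv_symbol l) <= 1.
Proof.
rewrite /dx_inv_symbol; case: eqVneq => [_|l0]; first by rewrite normc0.
rewrite normcV normcM normc_i mul1r.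
have -> : (l%:~R : R[i]) = (l%:~R)%:C%C by rewrite rmorph_int.
have l1 : 1 <= `|l%:~R : R| by rewrite -intr_norm ler1z -gtz0_ge1 normr_gt0.
by rewrite normc_real invf_le1 // (lt_le_trans ltr01).
Qed.

Lemma wbound_dx_inv_symbol a K : hb a K -> hb (fun l => dx_inv_symbol l * a l) K.
Proof.
apply: wbound_dom => // l; rewrite normcM; apply: ler_piMl; [exact: normc_ge0|exact: normc_dx_inv_symbol].
Qed.

Lemma wbound_summable_by a K : hb a K -> exists S, summable_by a S.
Proof. by have [S _ h] := wbound_summable hr => /h; eexists; eassumption. Qed.

Lemma wbound_synth a K : hb a K -> bmeas (synth a) /\ hat (synth a) = a.
Proof.
move=> /wbound_summable_by[S hS]; split; first exact: synth_bmeas hS.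
by apply/funext => l; exact: fourier_coef_synth hS.
Qed.

Lemma convol_wbound a K : hb a K -> exists L, hb (convol a a) L.
Proof.
have [C _ hC] := bilin_wbound hr => ha.
by exists (1 * C * K * K); apply: hC => //; exact: normc_cst1.
Qed.

Lemma hat_sqr f K : L2T f -> hb (hat f) K -> hat (fun x => f x ^+ 2) = convol (hat f) (hat f).
Proof.
move=> Lf /wbound_summable_by[S hS]; apply/funext => l.
rewrite /hat (fourier_coef_sqr l Lf hS); apply: csum_eq => k; by rewrite mul1r.
Qed.

Lemma synth_L2T a K : hb a K -> L2T (synth a).
Proof.
by move=> /wbound_synth[h _]; apply: bmeas_L2T => // x; exact: synth_periodic.
Qed.

(** When k and l - k are both nonzero, the product of 1 / (i k) and
    1 / (i (l - k)) is - 1 / (k (l - k)), the denominator in [expint] up to a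
    constant, and the numerator is the difference of the two products formed with
    [dx_inv]. When one of them is zero there is no oscillation and the term grows
    like tau; in the scheme the factor 2 of the zero mode counts the pair (0, 0)
    twice, and the square of the zero mode corrects it. *)
Lemma kern_decomposition eps tau a l k : let d k := dx_inv_symbol k * a k in
  let c := 'i%C * (eps * tau)%:C%C in
  - ('i%C * eps%:C%C) * (kern tau l k * a k * a (l - k)) =
  (eps / 2)%:C%C * (1 * evol tau d k * evol tau d (l - k)) +
  - ((eps / 2)%:C%C * phase tau l) * (1 * d k * d (l - k)) +
  ((if k == 0 then - c * phase tau l * a 0 * a (l - k) else 0) +
   (if k == l then - c * phase tau l * a k * a 0 else 0) +
   (if k == 0 then if l == 0 then c * a 0 ^+ 2 else 0 else 0)).
Proof.
move=> d c; have i0 : 'i%C != 0 :> R[i] by apply/eqP => /(congr1 (@normc R)) /eqP; rewrite normc_i normc0 oner_eq0.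
have i2 : 'i%C * 'i%C = -1 :> R[i] by rewrite -expr2 sqr_i.
have iV : 'i%C^-1 = - 'i%C :> R[i] by apply: (mulfI i0); rewrite divff // mulrN i2 opprK.
have ii (z w A B p q : R[i]) :
    1 * (p * ((- 'i%C * z) * A)) * (q * ((- 'i%C * w) * B)) = p * q * (- z * w * A * B).
  transitivity (p * q * (('i%C * 'i%C) * z * w * A * B)); first by ring.
  by rewrite i2; ring.
have tC : (eps * tau)%:C%C = eps%:C%C * tau%:C%C :> R[i] by rewrite rmorphM.
have hC : (eps / 2)%:C%C = eps%:C%C / 2 :> R[i] by rewrite rmorphM fmorphV rmorph_nat.
have d0 : d 0 = 0 by rewrite /d /dx_inv_symbol eqxx mul0r.
rewrite /kern /c tC hC /evol.
have [->|k0] := eqVneq k 0.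
  have -> : resonance l 0 = 0 :> R by rewrite /resonance mulr0 mul0r.
  rewrite d0 subr0 /expint !eqxx [0 == l]eq_sym.
  have p0 : phase tau 0 = 1 by rewrite /phase expr0n /= mulr0 oppr0 expi0.
  by case: eqVneq => [->|l0]; rewrite ?p0; ring.
have [->|kl] := eqVneq k l.
  rewrite subrr d0.
  have -> : resonance l l = 0 :> R by rewrite /resonance subrr mulr0.
  by rewrite /expint eqxx; ring.
have lk0 : l - k != 0 by rewrite subr_eq0 eq_sym.
have kR : (k%:~R : R) != 0 by rewrite intr_eq0.
have lkR : ((l - k)%:~R : R) != 0 by rewrite intr_eq0.
have kC : (k%:~R : R[i]) != 0 by rewrite intr_eq0.
have lkC : ((l - k)%:~R : R[i]) != 0 by rewrite intr_eq0.
have res0 : resonance l k != 0 :> R by rewrite /resonance !mulf_neq0 // pnatr_eq0.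
have resC : (resonance l k)%:C%C = 2 * k%:~R * (l - k)%:~R :> R[i].
  by rewrite /resonance !rmorphM !rmorph_int rmorph_nat.
have P : phase tau k * phase tau (l - k) = phase tau l * expi (resonance l k * tau).
  by rewrite -phase_resonance subrr phase0 mul1r.
rewrite /expint (negPf res0) /d /dx_inv_symbol (negPf k0) (negPf lk0) !addr0 resC.
have -> : 1 * (phase tau k * (('i%C * k%:~R)^-1 * a k)) * (phase tau (l - k) * (('i%C * (l - k)%:~R)^-1 * a (l - k)))
  = (phase tau l * expi (resonance l k * tau)) * (- (k%:~R)^-1 * ((l - k)%:~R)^-1 * a k * a (l - k)).
  rewrite -P; have := ii (k%:~R)^-1 ((l - k)%:~R)^-1 (a k) (a (l - k)) (phase tau k) (phase tau (l - k)).
  by rewrite -iV -!invfM.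
have -> : 1 * (('i%C * k%:~R)^-1 * a k) * (('i%C * (l - k)%:~R)^-1 * a (l - k)) =
   - (k%:~R)^-1 * ((l - k)%:~R)^-1 * a k * a (l - k).
  have := ii (k%:~R)^-1 ((l - k)%:~R)^-1 (a k) (a (l - k)) 1 1.
  by rewrite -iV -!invfM !mul1r.
move: kC lkC i0; move: (k%:~R : R[i]) ((l - k)%:~R : R[i]) ('i%C : R[i]) => z z' j.
move=> h1 h2 h3; field.
by rewrite h1 h2 h3.
Qed.

(** Sum [kern_decomposition] over k; the zero-mode terms are sums of one term. *)
Lemma lri_step_hat eps tau v K : L2T v -> hb (hat v) K ->
  L2T (lri_step eps tau v) /\ hat (lri_step eps tau v) = lri_seq eps tau (hat v).
Proof.
move=> Lv hv; set a := hat v in hv *.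
pose d l := dx_inv_symbol l * a l.
have hd : hb d K by exact: wbound_dx_inv_symbol.
have he := wbound_evol hr tau hv; have hde := wbound_evol hr tau hd.
have [Q hq] := convol_wbound hd; have hqe := wbound_evol hr tau hq.
have [be He] := wbound_synth he; have [bde Hde] := wbound_synth hde; have [bqe Hqe] := wbound_synth hqe.
have [_ Hd] := wbound_synth hd.
pose c1 := 1 - 2 * 'i%C * (eps * tau)%:C%C * a 0.
pose c0 := 'i%C * (eps * tau)%:C%C * a 0 ^+ 2.
pose c2 : R[i] := (eps / 2)%:C%C.
have E : lri_step eps tau v = (fun x => (c1 * synth (evol tau a) x + c0 * 1) +
    c2 * (synth (evol tau d) x ^+ 2 - synth (evol tau (convol d d)) x)).
  apply/funext => x; rewrite /lri_step mulr1; congr (_ + _ * (_ ^+ 2 - _)).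
    by rewrite schrodinger_synth dx_inv_synth Hd.
  rewrite schrodinger_synth; congr synth; congr evol.
  by rewrite dx_inv_synth (hat_sqr (K := K) (synth_L2T hd)) Hd.
have b2 : bmeas (fun x => synth (evol tau d) x ^+ 2) by exact: bmeasM.
have bE : bmeas (lri_step eps tau v).
  rewrite E; apply: bmeasD; last by apply: bmeasZ; exact: bmeasB.
  by apply: bmeasD; [exact: bmeasZ|exact: bmeas_cst].
split.
  apply: bmeas_L2T => // x; rewrite E !synth_periodic //.
apply/funext => l; rewrite /hat E.
have c_ f : bmeas f -> cintegrable f by exact: bmeas_cintegrable.
rewrite fourier_coefD; last 2 first.
- by apply: c_; apply: bmeasD; [exact: bmeasZ|exact: bmeas_cst].
- by apply: c_; apply: bmeasZ; exact: bmeasB.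
rewrite fourier_coefD; last 2 first.
- by apply: c_; exact: bmeasZ.
- exact: cintegrable_cst.
rewrite !fourier_coefZ; last 3 first.
- by first [exact: cintegrable_cst | exact: c_ | apply: c_; exact: bmeasB].
- by first [exact: cintegrable_cst | exact: c_ | apply: c_; exact: bmeasB].
- by first [exact: cintegrable_cst | exact: c_ | apply: c_; exact: bmeasB].
rewrite fourier_coefB; last 2 first.
- exact: c_.
- exact: c_.
rewrite fourier_coef1 -!/(hat _) He Hqe (hat_sqr (K := K) (synth_L2T hde)) ?Hde //.
have hk l' k : normc (kern tau l' k) <= `|tau| by exact: normc_kern.
have T0 := ctendsZ (- ('i%C * eps%:C%C)) (summable_by_cvg (bilin_summable hr l hk hv hv)).
have T1 := ctendsZ c2 (summable_by_cvg (bilin_summable hr l normc_cst1 hde hde)).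
have T2 := ctendsZ (- (c2 * phase tau l)) (summable_by_cvg (bilin_summable hr l normc_cst1 hd hd)).
pose c := 'i%C * (eps * tau)%:C%C : R[i].
have T3 := ctends_delta 0 (fun k => - c * phase tau l * a 0 * a (l - k)).
have T4 := ctends_delta l (fun k => - c * phase tau l * a k * a 0).
have T5 := ctends_delta 0 (fun=> if l == 0 then c * a 0 ^+ 2 else 0).
have T := ctendsD (ctendsD T1 T2) (ctendsD (ctendsD T3 T4) T5).
have {}T := fun H => ctends_unique T0 (ctends_eq H T).
have -> : lri_seq eps tau a l = phase tau l * a l +
    - ('i%C * eps%:C%C) * csum (fun k => kern tau l k * a k * a (l - k)).
  by rewrite /lri_seq mulNr.
rewrite T.
  rewrite /convol /bilin /evol -/c2 subr0 /c1 /c0 /c.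
  by case: (l == 0); ring.
move=> N; rewrite -!psumZ -!psumD; apply: eq_psum => k _.
exact: kern_decomposition.
Qed.

End FunctionsAndSequences.

(** * Mild solutions mode by mode, and the error bound *)
Section Duhamel.
Context {R : realType}.
Variable r : R.
Hypothesis hr : 1 / 2 < r.
Implicit Types (s t tau eps d : R) (f v phi I : R -> R[i]) (l : int) (K L M : R).
Notation hb := (wbound r).

(** The weights are at least 1. *)
Lemma wbound_mode a K l : hb a K -> normc (a l) <= K.
Proof.
move=> [K0 ha]; rewrite -ler_sqr ?nnegrE ?normc_ge0 // -sqmodE.
have := psum_term_le l (weighted_sqmod_ge0 hr a) ha; apply: le_trans.
by rewrite ler_peMl ?sqmod_ge0 // wt_ge1.
Qed.

Lemma Hr_wbound f : Hr r f -> exists K, hb (hat f) K.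
Proof. by move=> [_ /(sobolev_norm_fin hr)]. Qed.

Lemma Hr_cintegrable f : Hr r f -> cintegrable f.
Proof. by move=> [/L2T_cintegrable]. Qed.

(** Convergence in H^r implies convergence of each mode, by [wbound_mode]; the
    tags are the left endpoints. *)
Lemma Hr_integral_riemann a b (F : R -> R -> R[i]) I (m : nat -> nat) (p : nat -> nat -> R) :
  is_Hr_integral r a b F I ->
  (forall n, p n 0%N = a) -> (forall n, p n (m n) = b) ->
  (forall n k, (k < m n)%N -> p n k <= p n k.+1) ->
  (forall d, 0 < d -> exists N, forall n, (N <= n)%N -> forall k, (k < m n)%N -> p n k.+1 - p n k < d) ->
  forall l, ctends (fun n => \sum_(k < m n) (p n k.+1 - p n k)%:C%C * hat (F (p n k)) l) (hat I l).
Proof.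
move=> [FH IH conv_] p0 pm pmono pmesh l; apply/ctendsP => e e0.
have e2 : 0 < e / 2 by rewrite divr_gt0.
have [d d0 hd] := conv_ _ e2; have [N hN] := pmesh _ d0.
exists N => n Nn.
have prange k : (k <= m n)%N -> a <= p n k <= b.
  move=> km; apply/andP; split.
    elim: k km => [|k IHk] km; first by rewrite p0.
    by apply: le_trans (IHk (ltnW km)) (pmono n k km).
  rewrite -(pm n) -(subKn km); elim: (m n - k)%N => [|i IHi]; first by rewrite subn0.
  have [im|im] := ltnP i (m n); last first.
    have e1 : (m n - i.+1)%N = (m n - i)%N by lia.
    by rewrite e1.
  apply: le_trans IHi; have -> : (m n - i)%N = (m n - i.+1).+1 by lia.
  by apply: pmono; lia.
have ci (i : 'I_(m n)) : cintegrable (fun x => (p n i.+1 - p n i)%:C%C * F (p n i) x).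
  by apply: cintegrableZ; apply: Hr_cintegrable; apply: FH; apply: prange; exact: ltnW.
have step k : (k < m n)%N -> p n k <= p n k <= p n k.+1 /\ p n k.+1 - p n k < d.
  by move=> km; split; [rewrite lexx pmono|exact: hN].
have /ltW/(sobolev_normP hr _ (ltW e2)) := hd (m n) (p n) (p n) (p0 n) (pm n) step.
move=> /(wbound_mode l); rewrite fourier_coefB; [|exact: cintegrable_sum|exact: Hr_cintegrable].
rewrite fourier_coef_sum //.
under eq_bigr => i _.
  rewrite fourier_coefZ; last by apply: Hr_cintegrable; apply: FH; apply: prange; exact: ltnW.
  over.
by move=> h; apply: le_lt_trans h _; lra.
Qed.

(** Uniform partition of [0, t] into n + 1 pieces, followed by one of [t, t + s]:
    the truncated subtraction and the minimum freeze one part while the other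
    runs. *)
Definition glued_node t s (n k : nat) : R :=
  t * (minn k n.+1)%:R / n.+1%:R + s * (k - n.+1)%:R / n.+1%:R.

Lemma glued_node_left t s n k : (k <= n.+1)%N -> glued_node t s n k = t * k%:R / n.+1%:R.
Proof.
by move=> kn; rewrite /glued_node (minn_idPl kn) (eqP kn) mulr0 mul0r addr0.
Qed.

Lemma glued_node_right t s n k : glued_node t s n (n.+1 + k)%N = t + s * k%:R / n.+1%:R.
Proof.
rewrite /glued_node (minn_idPr (leq_addr _ _)) addKn; congr (_ + _).
by rewrite mulfK // pnatr_eq0.
Qed.

Lemma glued_node_diff t s n k : glued_node t s n k.+1 - glued_node t s n k =
  if (k < n.+1)%N then t / n.+1%:R else s / n.+1%:R.
Proof.
have n0 : (n.+1%:R : R) != 0 by rewrite pnatr_eq0.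
have [kn|kn] := ltnP k n.+1.
  by rewrite !glued_node_left // 1?ltnW // -natr1; field.
by rewrite -(subnKC kn) -addnS !glued_node_right -natr1; field.
Qed.

(** The Duhamel formula read on mode l. *)
Lemma mild_hat eps S phi w t l : Hr r phi -> mild_solution r eps S phi w -> 0 <= t <= S ->
  exists2 I, is_Hr_integral r 0 t (fun s => schrodinger (t - s) (fun x => w s x ^+ 2)) I &
  hat (w t) l = phase t l * hat phi l - 'i%C * eps%:C%C * hat I l.
Proof.
move=> hphi [wH _ _ mild] tS; have [I hI hae] := mild _ tS; exists I => //.
have [K hK] := Hr_wbound hphi.
have [bs hs] := wbound_synth hr (wbound_evol hr t hK).
have ci : cintegrable (schrodinger t phi) by rewrite schrodinger_synth; exact: bmeas_cintegrable.
have cI : cintegrable I by case: hI => _ /Hr_cintegrable.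
rewrite /hat (fourier_coef_ae l (Hr_cintegrable (wH t tS)) _ hae); last first.
  by apply: cintegrableB => //; exact: cintegrableZ.
rewrite fourier_coefB //; last exact: cintegrableZ.
by rewrite fourier_coefZ // schrodinger_synth -!/(hat _) hs.
Qed.

(** The integrals over [0, t] and [0, t + s] are compared on partitions that have
    t as a node: on [0, t] the integrands differ by the factor phase s, so those
    parts cancel and only the Riemann sum over [t, t + s] is left. *)
Lemma mild_solution_seq eps S phi w : Hr r phi -> mild_solution r eps S phi w ->
  mild_seq eps S (fun t => hat (w t)).
Proof.
move=> hphi hw t s t0 s0 tsS l; have [wH _ _ _] := hw.
have tS : 0 <= t <= S by apply/andP; split; lra.
have tsS' : 0 <= t + s <= S by apply/andP; split; lra.
have t_leS : t <= S by lra.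
have [I0 hI0 ->] := mild_hat l hphi hw tS.
have [I1 hI1 ->] := mild_hat l hphi hw tsS'.
pose G u := convol (hat (w u)) (hat (w u)) l.
have hF u T' : 0 <= u <= S -> hat (schrodinger (T' - u) (fun x => w u x ^+ 2)) l = phase (T' - u) l * G u.
  move=> /wH Hu; have [K hK] := Hr_wbound Hu.
  rewrite schrodinger_synth (hat_sqr hr (K := K)) //; last by case: Hu.
  have [L hL] := convol_wbound hr hK.
  by have [_ ->] := wbound_synth hr (wbound_evol hr (T' - u) hL).
have n0 n : (n.+1%:R : R) != 0 by rewrite pnatr_eq0.
have R0 := Hr_integral_riemann (m := fun n => n.+1) (p := fun n k => t * k%:R / n.+1%:R) hI0.
have {}R0 : ctends (fun n => \sum_(k < n.+1) (t / n.+1%:R)%:C%C *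
    (phase (t - t * k%:R / n.+1%:R) l * G (t * k%:R / n.+1%:R))) (hat I0 l).
  have H n k : t * k.+1%:R / n.+1%:R - t * k%:R / n.+1%:R = t / n.+1%:R.
    by rewrite -natr1; field.
  apply: ctends_eq (R0 _ _ _ _ l) => [n|n|n|n k _|d d0].
  - apply: eq_bigr => k _; rewrite H hF //.
    by have := node_itv t0 (ltn_ord k); set u := _ / _ => /andP[? ?]; apply/andP; split; lra.
  - by rewrite mulr0 mul0r.
  - by rewrite mulfK.
  - by rewrite -subr_ge0 H divr_ge0.
  - by have [N hN] := inv_succ_small t d0; exists N => n /hN h k _; rewrite H.
have R1 := Hr_integral_riemann (m := fun n => (n.+1 + n.+1)%N) (p := glued_node t s) hI1.
have {}R1 : ctends (fun n =>
    \sum_(k < n.+1) (t / n.+1%:R)%:C%C *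
      (phase (t + s - t * k%:R / n.+1%:R) l * G (t * k%:R / n.+1%:R)) +
    \sum_(k < n.+1) (s / n.+1%:R)%:C%C *
      (phase (s - s * k%:R / n.+1%:R) l * G (t + s * k%:R / n.+1%:R))) (hat I1 l).
  apply: ctends_eq (R1 _ _ _ _ l) => [n|n|n|n k _|d d0].
  - rewrite big_split_ord /=; congr (_ + _); apply: eq_bigr => k _.
      rewrite glued_node_diff ltn_ord glued_node_left ?(ltnW (ltn_ord k)) // hF //.
      by have := node_itv t0 (ltn_ord k); set u := _ / _ => /andP[? ?]; apply/andP; split; lra.
    rewrite glued_node_diff ltnNge leq_addr /= glued_node_right hF.
      by congr (_ * (phase _ l * _)); ring.
    by have := node_itv s0 (ltn_ord k); set u := _ / _ => /andP[? ?]; apply/andP; split; lra.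
  - by rewrite glued_node_left // mulr0 mul0r.
  - by rewrite glued_node_right mulfK.
  - by rewrite -subr_ge0 glued_node_diff; case: ifP => _; rewrite divr_ge0.
  - have [N hN] := inv_succ_small t d0; have [M hM] := inv_succ_small s d0.
    exists (maxn N M) => n; rewrite geq_max => /andP[/hN h1 /hM h2] k _.
    by rewrite glued_node_diff; case: ifP.
have T := ctendsB (ctends_cst (phase s l * (phase t l * hat phi l - 'i%C * eps%:C%C * hat I0 l)))
  (ctendsZ ('i%C * eps%:C%C) (ctendsB R1 (ctendsZ (phase s l) R0))).
have -> : phase (t + s) l * hat phi l - 'i%C * eps%:C%C * hat I1 l =
  phase s l * (phase t l * hat phi l - 'i%C * eps%:C%C * hat I0 l) -
  'i%C * eps%:C%C * (hat I1 l - phase s l * hat I0 l).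
  by rewrite phaseD; ring.
apply: ctends_eq T => n; congr (_ - _ * _).
rewrite mulr_sumr addrAC -sumrB [X in _ = X + _]big1 ?add0r // => k _.
have -> : t + s - t * k%:R / n.+1%:R = s + (t - t * k%:R / n.+1%:R) by ring.
by rewrite phaseD; ring.
Qed.

(** Discrete Gronwall: n factors 1 + L h are at most exp (L h n), while the n local
    errors E h^2 add up. *)
Lemma gronwall_step (E L h : R) (n : nat) : 0 <= E -> 0 <= L -> 0 <= h ->
  (1 + L * h) * (E * h ^+ 2 * n%:R * expR (L * h * n%:R)) + E * h ^+ 2 <=
  E * h ^+ 2 * n.+1%:R * expR (L * h * n.+1%:R).
Proof.
move=> E0 L0 h0; have Lh : 0 <= L * h by exact: mulr_ge0.
have h1 : (1 + L * h) * expR (L * h * n%:R) <= expR (L * h * n.+1%:R).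
  rewrite -natr1 mulrDr mulr1 expRD [leLHS]mulrC ler_wpM2l ?expR_ge0 //.
  exact: expR_ge1Dx.
have h2 : 1 <= expR (L * h * n.+1%:R).
  by rewrite -expR0 ler_expR mulr_ge0.
set X := expR (L * h * n.+1%:R) in h1 h2 *; set Y := expR _ in h1 *.
have Eh : 0 <= E * h ^+ 2 by rewrite mulr_ge0 ?sqr_ge0.
have -> : (1 + L * h) * (E * h ^+ 2 * n%:R * Y) + E * h ^+ 2 =
  E * h ^+ 2 * (n%:R * ((1 + L * h) * Y) + 1) by ring.
rewrite -[leRHS]mulrA ler_wpM2l // -natr1 [leRHS]mulrDl mul1r lerD //.
by rewrite ler_wpM2l.
Qed.

End Duhamel.

Theorem theorem2p2 (R : realType) (r T : R) (hr : 1 / 2 < r) (hT : 0 < T)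
    (phi : R -> R[i]) (hphi : Hr r phi)
    (w : R -> R -> R -> R[i])
    (hw : forall eps : R, 0 < eps <= 1 ->
            mild_solution r eps (T / eps) phi (w eps))
    (hbound : exists M : R, forall eps : R, 0 < eps <= 1 ->
            forall t : R, 0 <= t <= T / eps ->
            (sobolev_norm r (w eps t) <= M%:E)%E) :
  exists tau0 C : R, [/\ 0 < tau0, 0 < C &
    forall eps : R, 0 < eps <= 1 ->
    forall tau : R, 0 < tau <= tau0 ->
    forall n : nat, n%:R <= T / eps / tau ->
      let err := fun x : R => w eps (n%:R * tau) x - lri eps tau phi n x in
      Hr r err /\ (sobolev_norm r err <= (C * eps * tau)%:E)%E].
Proof.
have [M hM] := hbound; have [C0 C0_gt0 [hlocal hstable]] := one_step_bounds hr.
have M0 : 0 <= M.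
  have h1 : 0 < (1 : R) <= 1 by rewrite ltr01 lexx.
  have h2 : 0 <= (0 : R) <= T / 1 by rewrite lexx divr1 ltW.
  by rewrite -lee_fin; apply: le_trans (hM _ h1 _ h2); exact: sqrte_ge0.
(* E (eps tau)^2 is the local error; L is the Lipschitz constant for an exact
   solution bounded by M and a numerical one bounded by M + 1. *)
pose E := 2 * C0 ^+ 2 * M ^+ 3; pose L := C0 * (M + (M + 1)).
have E0 : 0 <= E by rewrite !mulr_ge0 ?exprn_ge0 // ltW.
have L0 : 0 <= L by rewrite mulr_ge0 ?(ltW C0_gt0) // addr_ge0 // addr_ge0.
(* The summand 1 makes C positive; tau <= C^-1 keeps the error below 1. *)
pose C := E * T * expR (L * T) + 1.
have C_ge1 : 1 <= C by rewrite lerDr !mulr_ge0 ?expR_ge0 // ltW.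
have C_gt0 : 0 < C by exact: lt_le_trans C_ge1.
exists C^-1, C; split; [by rewrite invr_gt0|by []|].
move=> eps heps tau /andP[tau_gt0 tauC] n hn err.
have /andP[eps_gt0 eps1] := heps.
(* The error after n steps is measured in h = eps tau, with n h <= T. *)
pose h := eps * tau; have h_ge0 : 0 <= h by rewrite mulr_ge0 // ltW.
have hseq := mild_solution_seq hr hphi (hw _ heps).
have hWM t : 0 <= t <= T / eps -> wbound r (hat (w eps t)) M.
  by move=> /(hM _ heps) /(sobolev_normP hr _ M0).
have time_le m : m%:R <= T / eps / tau -> m%:R * tau <= T / eps by rewrite ler_pdivlMr.
have errC m : m%:R <= T / eps / tau ->
    E * h ^+ 2 * m%:R * expR (L * h * m%:R) <= C * eps * tau.
  move=> /time_le; rewrite ler_pdivlMr // => mT.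
  have hm : h * m%:R <= T by rewrite /h; lra.
  have hm0 : 0 <= h * m%:R by rewrite mulr_ge0.
  apply: (@le_trans _ _ (E * T * expR (L * T) * h)).
    have -> : E * h ^+ 2 * m%:R * expR (L * h * m%:R) =
       E * (h * m%:R) * expR (L * (h * m%:R)) * h by rewrite (mulrA L); ring.
    apply: ler_wpM2r => //; apply: ler_pM.
    - exact: mulr_ge0.
    - exact: expR_ge0.
    - exact: ler_wpM2l.
    - by rewrite ler_expR ler_wpM2l.
  by rewrite -[leRHS]mulrA -/h ler_wpM2r // lerDl.
have main m : m%:R <= T / eps / tau ->
  [/\ L2T (lri eps tau phi m), wbound r (hat (lri eps tau phi m)) (M + 1) &
      wbound r (fun l => hat (w eps (m%:R * tau)) l - hat (lri eps tau phi m) l)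
        (E * h ^+ 2 * m%:R * expR (L * h * m%:R))].
  elim: m => [|m IH] hm.
    have [wH _ w0 _] := hw _ heps.
    have i0 : 0 <= (0 : R) <= T / eps by rewrite lexx divr_ge0 // ltW.
    have e0 : hat (w eps 0) = hat phi.
      apply/funext => l; apply: fourier_coef_ae w0.
        exact: (Hr_cintegrable (wH 0 i0)).
      exact: (Hr_cintegrable hphi).
    split; first by case: hphi.
      by rewrite /= -e0; apply: wbound_le (hWM _ i0); rewrite lerDl.
    rewrite mul0r e0 mulr0 mul0r; under eq_fun do rewrite subrr; exact: wbound0.
  have hm' : m%:R <= T / eps / tau by apply: le_trans hm; rewrite ler_nat.
  have [Lm bm dm] := IH hm'.
  have [LS eS] := lri_step_hat hr eps tau Lm bm.
  have tm : 0 <= m%:R * tau by rewrite mulr_ge0 // ltW.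
  have tS : m%:R * tau + tau <= T / eps.
    by have := time_le _ hm; rewrite -natr1 mulrDl mul1r.
  have et : m.+1%:R * tau = m%:R * tau + tau by rewrite -natr1 mulrDl mul1r.
  have bW : wbound r (hat (w eps (m%:R * tau))) M.
    by apply: hWM; apply/andP; split => //; lra.
  have loc := hlocal _ _ _ _ (ltW eps_gt0) hseq hWM _ _ tm (ltW tau_gt0) tS.
  have sta := hstable _ _ _ _ _ _ _ (ltW eps_gt0) (ltW tau_gt0) bW bm dm.
  have err_ : wbound r (fun l => hat (w eps (m.+1%:R * tau)) l - hat (lri eps tau phi m.+1) l)
        (E * h ^+ 2 * m.+1%:R * expR (L * h * m.+1%:R)).
    rewrite et [lri _ _ _ m.+1]/= -/(lri eps tau phi m) eS.
    have := wboundD hr sta loc.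
    have -> : (fun l => lri_seq eps tau (hat (w eps (m%:R * tau))) l -
        lri_seq eps tau (hat (lri eps tau phi m)) l +
        (hat (w eps (m%:R * tau + tau)) l - lri_seq eps tau (hat (w eps (m%:R * tau))) l)) =
      (fun l => hat (w eps (m%:R * tau + tau)) l - lri_seq eps tau (hat (lri eps tau phi m)) l).
      by apply/funext => l; rewrite addrC addrA subrK.
    by apply: wbound_le; exact: gronwall_step.
  split; [exact: LS| |exact: err_].
  have -> : hat (lri eps tau phi m.+1) = (fun l => hat (w eps (m.+1%:R * tau)) l -
      (hat (w eps (m.+1%:R * tau)) l - hat (lri eps tau phi m.+1) l)).
    by apply/funext => l; rewrite opprB addrC subrK.
  apply: (wboundB hr); first by apply: hWM; rewrite et; apply/andP; split=> //; lra.
  apply: wbound_le err_; apply: le_trans (errC _ hm) _.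
  have c1 : C * tau <= 1 by rewrite mulrC -ler_pdivlMr // div1r.
  by rewrite mulrAC (le_trans _ c1) // ler_piMr // mulr_ge0 // ltW.
have [Ln bn dn] := main n hn.
have [wH _ _ _] := hw _ heps.
have Hw : Hr r (w eps (n%:R * tau)).
  by apply: wH; rewrite time_le // andbT mulr_ge0 // ltW.
have Le : L2T err by apply: L2TD; [case: Hw|exact: L2TN].
have CC : 0 <= C * eps * tau by rewrite !mulr_ge0 // ltW.
have N : (sobolev_norm r err <= (C * eps * tau)%:E)%E.
  apply/(sobolev_normP hr) => //; apply: wbound_le (errC _ hn) _.
  have -> // : fourier_coef err = (fun l => hat (w eps (n%:R * tau)) l - hat (lri eps tau phi n) l).
  by apply/funext => l; rewrite fourier_coefB //; [exact: Hr_cintegrable Hw|exact: L2T_cintegrable].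
by split=> //; split=> //; apply: le_lt_trans N _; rewrite ltry.
Qed.
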